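(* Let $p\in[1,\infty)$ and $n\geq3$. A function $\Psi:L^{p}(\mathbb{R}^n,\vert x\vert^{2}dx)\rightarrow\mathbb{M}^n$ is a continuous $\mathrm{SL}(n)$ covariant valuation if and only if there exists $\xi\in\widetilde{A}(\mathbb{R})$ such that $$\Psi(h)=\mathrm{K}(\xi\circ h)$$ for all $h\in L^{p}(\mathbb{R}^n,\vert x\vert^{2}dx)$.
   Context: For $p\in[1,\infty)$, $L^{p}(\mathbb{R}^n,\vert x\vert^{2}dx)$ is the space of (Lebesgue) measurable functions $h:\mathbb{R}^n\to\mathbb{R}$ with $\int_{\mathbb{R}^n}\vert h(x)\vert^{p}\vert x\vert^{2}dx<\infty$, functions equal almost everywhere being identified, with norm $\left(\int_{\mathbb{R}^n}\vert h(x)\vert^{p}\vert x\vert^{2}dx\right)^{1/p}$, where $\vert x\vert$ is the Euclidean norm. $\mathbb{M}^n$ is the set of real $n\times n$ matrices (no symmetry assumed). For an operator $\Psi:L^{p}(\mathbb{R}^n,\vert x\vert^2dx)\to\mathbb{M}^n$: - $\Psi$ is continuous if $\Psi(h_k)\to\Psi(h)$ whenever $h_k\to h$ in the norm of $L^{p}(\mathbb{R}^n,\vert x\vert^{2}dx)$, that is, whenever $\left(\int_{\mathbb{R}^n}\vert h_k(x)-h(x)\vert^{p}\vert x\vert^{2}dx\right)^{1/p}\to0$ as $k\to\infty$. - $\Psi$ is $\mathrm{SL}(n)$ covariant if $\Psi(h\circ\phi^{-1})=\phi\,\Psi(h)\,\phi^{t}$ for all $h$ and all $\phi\in\mathrm{SL}(n)$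 (real matrices of determinant $1$). - $\Psi$ is a valuation if $\Psi(h\vee f)+\Psi(h\wedge f)=\Psi(h)+\Psi(f)$ for all $h,f$, where $h\vee f=\max\{h,f\}$ and $h\wedge f=\min\{h,f\}$ pointwise. The moment matrix $\mathrm{K}(g)$ of a measurable $g:\mathbb{R}^n\to\mathbb{R}$ is the $n\times n$ matrix with entries $\mathrm{K}_{ij}(g)=\int_{\mathbb{R}^n}g(x)x_ix_j\,dx$. $\widetilde{A}(\mathbb{R})$ is the set of continuous functions $\xi:\mathbb{R}\to\mathbb{R}$ for which there is $d\in\mathbb{R}$ with $\vert\xi(t)\vert\le d\vert t\vert^{p}$ for every $t\in\mathbb{R}$ (same $p$). *)

(* Defs.v *)
From HB Require Import structures.
From mathcomp Require Import all_boot all_order all_algebra.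
From mathcomp Require Import all_classical all_reals all_analysis.
Set Implicit Arguments.
Unset Strict Implicit.
Unset Printing Implicit Defensive.
Import Order.TTheory GRing.Theory Num.Theory.
Import numFieldNormedType.Exports.
Local Open Scope classical_set_scope.
Local Open Scope ring_scope.

Definition measure_cV_display : measure_display. Proof. exact. Qed.

Section measurable_cV.
Context {R : realType} (n : nat).

(* R^n is 'cV[R]_n, on which matrices act by *m. Its measurable sets are the
   Borel sets, generated by the coordinates as in the instance for n.-tuple. *)
Definition cV_coord (i : 'I_n) (x : 'cV[R]_n) : measurableTypeR R := x i 0.

Let cV_set0 : g_sigma_preimage cV_coord set0.
Proof. exact: sigma_algebra0. Qed.

Let cV_setC A : g_sigma_preimage cV_coord A -> g_sigma_preimage cV_coord (~` A).
Proof. exact: sigma_algebraC. Qed.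

Let cV_bigcup (F : (set 'cV[R]_n)^nat) :
  (forall i, g_sigma_preimage cV_coord (F i)) ->
  g_sigma_preimage cV_coord (\bigcup_i (F i)).
Proof. exact: sigma_algebra_bigcup. Qed.

HB.instance Definition _ := @isMeasurable.Build measure_cV_display
  'cV[R]_n (g_sigma_preimage cV_coord) cV_set0 cV_setC cV_bigcup.

End measurable_cV.

Section measurable_fun_cV.
Context {R : realType}.

Lemma measurable_cV_coord n (i : 'I_n) :
  measurable_fun [set: 'cV[R]_n] (cV_coord i).
Proof.
move=> _ Y mY; rewrite setTI; apply: sub_sigma_algebra => /=.
rewrite -bigcup_seq/=; exists i => /=; first by rewrite mem_index_enum.
by exists Y => //; rewrite setTI.
Qed.

Lemma measurable_fun_cVP d (T : measurableType d) n (f : T -> 'cV[R]_n) :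
  (forall i, measurable_fun [set: T] (cV_coord i \o f)) ->
  measurable_fun [set: T] f.
Proof.
move=> mf _ A mA; rewrite setTI.
have : preimage_set_system setT f (g_sigma_preimage (@cV_coord R n))
    `<=` measurable.
  rewrite -g_sigma_preimage_comp.
  apply: smallest_sub; first exact: sigma_algebra_measurable.
  by rewrite -bigcup_seq/= => B [i _ [C mC <-]]; exact: mf.
by apply; exists A => //; rewrite setTI.
Qed.

Definition cV_cons n (z : measurableTypeR R * 'cV[R]_n) : 'cV[R]_n.+1 :=
  col_mx (z.1)%:M z.2.

Definition cV_uncons n (x : 'cV[R]_n.+1) : measurableTypeR R * 'cV[R]_n :=
  (x 0 0, \col_i x (lift 0 i) 0).

Lemma cV_consK n : cancel (@cV_cons n) (@cV_uncons n).
Proof.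
case=> a v; rewrite /cV_uncons /cV_cons; congr pair => /=.
  by rewrite mxE; case: splitP => [j _|j]; rewrite ?mxE ?ord1.
apply/colP => i; rewrite mxE (_ : lift 0 i = rshift 1 i); last exact: val_inj.
by rewrite (@col_mxEd _ 1 n 1).
Qed.

Lemma measurable_cV_cons n : measurable_fun setT (@cV_cons n).
Proof.
apply: measurable_fun_cVP => i.
have [j|] := unliftP ord0 i => ->.
  rewrite (_ : _ \o _ = cV_coord j \o snd); last first.
    apply/funext => z; rewrite -[in RHS](cV_consK z) /=.
    by rewrite /cV_coord mxE.
  exact: measurableT_comp (measurable_cV_coord j) measurable_snd.
rewrite (_ : _ \o _ = fst); first exact: measurable_fst.
by apply/funext => z; rewrite -[in RHS](cV_consK z).
Qed.

Lemma measurable_cV_uncons n : measurable_fun setT (@cV_uncons n).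
Proof.
apply: measurable_fun_pair; first exact: (measurable_cV_coord 0).
apply: measurable_fun_cVP => i.
rewrite (_ : _ \o _ = cV_coord (lift 0 i)); first exact: measurable_cV_coord.
by apply/funext => x; rewrite /cV_coord /= mxE.
Qed.

End measurable_fun_cV.

Section lebesgue_measure_cV.
Context {R : realType}.

Section cV_cons_measure.
Variables (n : nat) (mu : {sigma_finite_measure set 'cV[R]_n -> \bar R}).

Definition cV_cons_measure : set 'cV[R]_n.+1 -> \bar R :=
  pushforward (@lebesgue_measure R \x mu)%E (@cV_cons R n).

Let cV_cons_measure0 : cV_cons_measure set0 = 0%E.
Proof. by rewrite /cV_cons_measure /pushforward preimage_set0 measure0. Qed.

Let cV_cons_measure_ge0 A : (0 <= cV_cons_measure A)%E.
Proof. by rewrite /cV_cons_measure /pushforward; exact: measure_ge0. Qed.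

Let cV_cons_measure_sigma_additive : semi_sigma_additive cV_cons_measure.
Proof.
have preim A : measurable A -> measurable (@cV_cons R n @^-1` A).
  by move=> mA; rewrite -[X in measurable X]setTI; exact: measurable_cV_cons.
move=> F mF tF mUF; rewrite /cV_cons_measure /pushforward preimage_bigcup.
apply: measure_semi_sigma_additive.
- by move=> i; exact: preim.
- by move=> i j _ _ [z [Fi Fj]]; apply: (tF i j) => //; exists (cV_cons z).
- by rewrite -preimage_bigcup; exact: preim.
Qed.

HB.instance Definition _ := isMeasure.Build _ _ _ cV_cons_measure
  cV_cons_measure0 cV_cons_measure_ge0 cV_cons_measure_sigma_additive.

Let cV_cons_measure_sigma_finite : sigma_finite setT cV_cons_measure.
Proof.
have /sigma_finiteP[F [TF ndF Foo]] := sigma_finiteT (@lebesgue_measure R).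
have /sigma_finiteP[G [TG ndG Goo]] := sigma_finiteT mu.
exists (fun k => @cV_uncons R n @^-1` (F k `*` G k)).
  rewrite -preimage_bigcup -(preimage_setT (@cV_uncons R n)); congr (_ @^-1` _).
  rewrite -setXTT TF TG predeqE => -[x y]; split.
    move=> [/= [i _ Fix] [j _ Gjy]]; exists (maxn i j) => //; split.
    - by move: x Fix; exact/subsetPset/ndF/leq_maxl.
    - by move: y Gjy; exact/subsetPset/ndG/leq_maxr.
  by move=> [i _ []/= ? ?]; split; exists i.
move=> k; have [mF Fk] := Foo k; have [mG Gk] := Goo k; split.
  rewrite -[X in measurable X]setTI.
  by apply: measurable_cV_uncons => //; exact: measurableX.
rewrite /cV_cons_measure /pushforward -comp_preimage.
rewrite (_ : _ \o _ = idfun); last by apply/funext => z /=; rewrite cV_consK.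
by rewrite preimage_id product_measure1E// lte_mul_pinfty// ge0_fin_numE.
Qed.

HB.instance Definition _ := Measure_isSigmaFinite.Build _ _ _ cV_cons_measure
  cV_cons_measure_sigma_finite.

End cV_cons_measure.

(* n-fold product of the one-dimensional Lebesgue measure, on Borel sets; the
   unique point of R^0 has mass 1. *)
Fixpoint borel_lebesgue_cV n : {sigma_finite_measure set 'cV[R]_n -> \bar R} :=
  if n is n'.+1 then cV_cons_measure (borel_lebesgue_cV n')
  else \d_(0 : 'cV[R]_0).

(* Its completion, as completed_lebesgue_measure for n = 1. It lives on the
   sigma-algebra of Lebesgue measurable sets, carried by the alias
   caratheodory_type of 'cV[R]_n; plain 'cV[R]_n keeps the Borel sets. *)
Definition lebesgue_cV n := @completed_measure_extension _ _ _ (borel_lebesgue_cV n).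
Arguments lebesgue_cV : clear implicits.
HB.instance Definition _ n := Measure.on (lebesgue_cV n).

End lebesgue_measure_cV.
Arguments lebesgue_cV {R} n.

Section definitions.
Context {R : realType}.
Implicit Types (p : R) (n : nat).

Definition lebesgue_measurable n (h : 'cV[R]_n -> R) : Prop :=
  measurable_fun [set: caratheodory_type (@borel_lebesgue_cV R n)^*%mu] h.

Definition enorm n (x : 'cV[R]_n) : R := Num.sqrt (\sum_(i < n) x i 0 ^+ 2).

Definition Lp_integral p n (h : 'cV[R]_n -> R) : \bar R :=
  (\int[lebesgue_cV n]_x (`|h x| `^ p * enorm x ^+ 2)%:E)%E.

Definition Lp_norm p n (h : 'cV[R]_n -> R) : \bar R :=
  (Lp_integral p h `^ p^-1)%E.

Definition Lp p n : set ('cV[R]_n -> R) :=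
  [set h | lebesgue_measurable h /\ (Lp_integral p h < +oo)%E].

Definition Lp_eq n (h f : 'cV[R]_n -> R) : Prop :=
  {ae lebesgue_cV n, forall x, h x = f x}.

(* An operator on L^p, whose elements are classes of functions modulo Lp_eq, is
   a map on representatives compatible with Lp_eq; its values at functions
   that are not in Lp are never used. *)
Definition Lp_operator p n (Psi : ('cV[R]_n -> R) -> 'M[R]_n) : Prop :=
  forall h f, Lp p h -> Lp p f -> Lp_eq h f -> Psi h = Psi f.

Definition Lp_continuous p n (Psi : ('cV[R]_n -> R) -> 'M[R]_n) : Prop :=
  forall (h_ : nat -> 'cV[R]_n -> R) (h : 'cV[R]_n -> R),
    (forall k, Lp p (h_ k)) -> Lp p h ->
    Lp_norm p (fun x => h_ k x - h x) @[k --> \oo] --> 0%E ->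
    Psi (h_ k) @[k --> \oo] --> Psi h.

Definition SL_covariant p n (Psi : ('cV[R]_n -> R) -> 'M[R]_n) : Prop :=
  forall (h : 'cV[R]_n -> R) (phi : 'M[R]_n), Lp p h -> \det phi = 1 ->
    Psi (fun x => h (invmx phi *m x)) = phi *m Psi h *m phi^T.

Definition valuation p n (Psi : ('cV[R]_n -> R) -> 'M[R]_n) : Prop :=
  forall h f : 'cV[R]_n -> R, Lp p h -> Lp p f ->
    Psi (fun x => Num.max (h x) (f x)) + Psi (fun x => Num.min (h x) (f x)) =
    Psi h + Psi f.

(* The real-valued integral is junk when its integrand is not integrable; for
   g = xi \o h with xi in Atilde p and h in Lp, all entries are integrable. *)
Definition moment_matrix n (g : 'cV[R]_n -> R) : 'M[R]_n :=
  \matrix_(i < n, j < n) \int[lebesgue_cV n]_x (g x * x i 0 * x j 0).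

Definition Atilde p : set (R -> R) :=
  [set xi | continuous xi /\ exists d : R, forall t, `|xi t| <= d * `|t| `^ p].

End definitions.

(* Main.v *)
(* Sufficiency. K(xi o h) inherits the valuation property pointwise, covariance
   is the invariance of Lebesgue measure under SL(n), and continuity follows
   from |xi(s) - xi(t)| <= C (|t|^p + |s - t|^p) together with the uniform
   continuity of xi on compact sets.

   Necessity. For a fixed level a, the set function M(E) = Psi(a 1_E) is a
   finitely additive, continuous, SL(n) covariant matrix valued charge. Let
   xi(a) be the ratio of the (i, i) entries of M and of E |-> K(1_E) at one
   cone, so that the difference D of M and xi(a) K has a vanishing (i, i) entry
   at this cone. That entry is invariant under the shears x_k += t x_i, which
   translate the coordinates x_k / x_i; by Cauchy's equation it vanishes on all
   boxes in these coordinates, hence everywhere. By polarization D is then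
   antisymmetric, its entries are again shear invariant, and comparing the
   actions of diag(2_i, 1/2_j) and diag(2_i, 1/2_k), for which n >= 3 is needed,
   gives D = 0. Continuity and growth of xi come from the continuity of Psi, and
   Psi - K(xi o .) vanishes because a nonnegative function is a limit of maxima
   of multiples of indicators of nested level sets. *)

From HB Require Import structures.
Require Import Defs.
From mathcomp Require Import all_boot all_order all_algebra.
From mathcomp Require Import all_classical all_reals all_analysis.
From mathcomp Require Import measurable_realfun ring lra.
Set Implicit Arguments.
Unset Strict Implicit.
Unset Printing Implicit Defensive.
Import Order.TTheory GRing.Theory Num.Theory.
Import numFieldNormedType.Exports.
Local Open Scope classical_set_scope.
Local Open Scope ring_scope.

(** * Lebesgue measure under linear maps *)

(** A charge is only finitely additive and may take both signs, so uniqueness of Lebesgue measure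
    says nothing about it. Continuity under dominated convergence of indicators replaces countable
    additivity, makes Cauchy's equation rigid and allows a Dynkin argument; insensitivity to null
    sets then leads from Borel to Lebesgue measurable sets. The shears leave x_l fixed and act only
    on the slopes x_k / x_l. They cannot change the height of a cone, so the matrices diag(d_l,
    1/d_k) are needed as well: d > 0 adjusts the height and d = -1 reaches the half-space x_l < 0,
    while the hyperplane x_l = 0 is null. Additivity of M requires Psi(0) = 0, which covariance
    supplies because for n >= 3 only the zero matrix is fixed by all of SL(n). Functions of both
    signs are handled by applying the valuation identity to h and 0. Homotheties lie outside SL(n);
    they serve only the growth of xi, where weighted integrals of sets are homogeneous of degree n +
    2. *)

Section line_lebesgue.
Context {R : realType}.
Local Notation lam := (@lebesgue_measure R).

Lemma lebesgue_measure_shift (v : R) (A : set (measurableTypeR R)) :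
  measurable A -> lam ((fun x => x + v) @^-1` A) = lam A.
Proof.
move=> mA; have mf : measurable_fun setT (fun x : measurableTypeR R => x + v : measurableTypeR R).
  by apply: measurable_funD => //; exact: measurable_cst.
apply/esym/(@lebesgue_measure_unique R (pushforward lam (fun x : measurableTypeR R => x + v :
    measurableTypeR R))) => // _ [[a b]] _ <-.
transitivity (lam `]a - v, b - v]%classic); last first.
  congr (lam _).
  by apply/seteqP; split => x /=; rewrite !in_itv/= ltrBlDr lerBrDr.
rewrite !lebesgue_measure_itv/= !lte_fin ltrD2r; case: ifP => //.
by move=> _; rewrite -!EFinD; congr EFin; ring.
Qed.

(** The pushforward multiplied by r agrees with [lam] on half-open intervals, and these determine
    Lebesgue measure. *)
Lemma lebesgue_measure_scale (r : R) (A : set (measurableTypeR R)) : 0 < r ->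
  measurable A -> lam ((fun x => r * x) @^-1` A) = (r^-1%:E * lam A)%E.
Proof.
move=> r0 mA; have mf : measurable_fun setT (fun x : measurableTypeR R => r * x : measurableTypeR
    R).
  by apply: measurable_funM => //; exact: measurable_cst.
rewrite (@lebesgue_measure_unique R (mscale (NngNum (ltW r0)) (pushforward lam (fun x :
    measurableTypeR R => r * x : measurableTypeR R))) _ A) //=.
  by rewrite /mscale/= muleA -EFinM mulVf ?mul1e// gt_eqF.
move=> _ [[a b]] _ <-.
transitivity (r%:E * lam `](r^-1 * a)%R, (r^-1 * b)%R]%classic)%E; last first.
  rewrite /mscale /=; congr (_ * _)%E; congr (lam _).
  by apply/seteqP; split => x /=; rewrite !in_itv/= ltr_pdivrMl ?ler_pdivlMl.
rewrite !lebesgue_measure_itv/= !lte_fin ltr_pM2l ?invr_gt0//; case: ifP => // _.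
  rewrite -!EFinD -EFinM; congr EFin; field; by rewrite gt_eqF.
by rewrite mule0.
Qed.

End line_lebesgue.

Section borel_linear.
Context {R : realType}.
Local Notation lam := (@lebesgue_measure R).
Local Notation bl n := (@borel_lebesgue_cV R n).

Lemma measurable_mulmx m n (A : 'M[R]_(m, n)) :
  measurable_fun [set: 'cV[R]_n] (mulmx A : 'cV[R]_n -> 'cV[R]_m).
Proof.
apply: measurable_fun_cVP => i.
rewrite (_ : _ \o _ = fun x => \sum_j A i j * cV_coord j x).
  by apply: measurable_sum => j; apply: measurable_funM => //; exact: measurable_cV_coord.
by apply/funext => x; rewrite /cV_coord /= mxE.
Qed.

Lemma measurable_addmx n (v : 'cV[R]_n) :
  measurable_fun [set: 'cV[R]_n] (fun x : 'cV[R]_n => x + v).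
Proof.
apply: measurable_fun_cVP => i.
rewrite (_ : _ \o _ = fun x => cV_coord i x + v i 0).
  by apply: measurable_funD => //; exact: measurable_cV_coord.
by apply/funext => x; rewrite /cV_coord /= mxE.
Qed.

(** Stated with preimages, so that composing needs no inverse; for an invertible matrix the factor
    is 1 / |det|. *)
Definition scales n (f : 'cV[R]_n -> 'cV[R]_n) (c : R) :=
  measurable_fun [set: 'cV[R]_n] f /\
  forall E, measurable E -> bl n (f @^-1` E) = (c%:E * bl n E)%E.

Lemma scales_comp n f g c d : @scales n f c -> @scales n g d -> @scales n (f \o g) (d * c).
Proof.
move=> [mf sf] [mg sg]; split; first exact: measurableT_comp.
move=> E mE; rewrite comp_preimage sg ?sf ?muleA// -[X in measurable X]setTI; exact: mf.
Qed.

Lemma borel_lebesgue_xsection n (E : set 'cV[R]_n.+1) :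
  bl n.+1 E = (\int[lam]_a bl n [set v | E (cV_cons (a, v))])%E.
Proof.
rewrite [LHS]/= /cV_cons_measure /pushforward /product_measure1.
apply: eq_integral => a _ /=; congr (bl n _).
by apply/seteqP; split => v; rewrite /xsection/= inE.
Qed.

(** The recursive definition integrates the first coordinate last. Uniqueness of the product measure
    reverses the order, as needed for maps that move only the first coordinate. *)
Lemma borel_lebesgue_ysection n (E : set 'cV[R]_n.+1) : measurable E ->
  bl n.+1 E = (\int[bl n]_v lam [set a | E (cV_cons (a, v))])%E.
Proof.
move=> mE; rewrite [LHS]/= /cV_cons_measure /pushforward.
rewrite (@product_measure_unique _ _ _ _ _ lam (bl n) (lam \x^ bl n)%E).
- apply: eq_integral => a _ /=; congr (lam _).
  by apply/seteqP; split => v; rewrite /ysection/= inE.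
- by move=> A B mA mB; rewrite /= product_measure2E.
- by rewrite -[X in measurable X]setTI; exact: measurable_cV_cons.
Qed.

Lemma measurable_section n (E : set 'cV[R]_n.+1) a : measurable E ->
  measurable [set v : 'cV[R]_n | E (cV_cons (a, v))].
Proof.
move=> mE; rewrite -[X in measurable X]setTI.
have : measurable_fun setT (fun v : 'cV[R]_n => cV_cons (a : measurableTypeR R, v)).
  rewrite (_ : (fun _ => _) = @cV_cons R n \o (fun v => (a : measurableTypeR R, v)))//.
  apply: (measurableT_comp (@measurable_cV_cons R n)).
  exact: measurable_fun_pair.
by apply.
Qed.

Lemma measurable_section2 n (E : set 'cV[R]_n.+1) (v : 'cV[R]_n) : measurable E ->
  measurable [set a : measurableTypeR R | E (cV_cons (a, v))].
Proof.
move=> mE; rewrite -[X in measurable X]setTI.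
have : measurable_fun setT (fun a : measurableTypeR R => cV_cons (a, v)).
  rewrite (_ : (fun _ => _) = @cV_cons R n \o (fun a => (a, v)))//.
  apply: (measurableT_comp (@measurable_cV_cons R n)).
  exact: measurable_fun_pair.
by apply.
Qed.

Lemma measurable_borel_lebesgue_section n (E : set 'cV[R]_n.+1) : measurable E ->
  measurable_fun setT (fun a : measurableTypeR R => bl n [set v | E (cV_cons (a, v))]).
Proof.
move=> mE; have := @measurable_fun_xsection _ _ (measurableTypeR R) 'cV[R]_n R (bl n) (@cV_cons R
    n @^-1` E).
have -> : (fun a : measurableTypeR R => bl n [set v | E (cV_cons (a, v))]) =
   (bl n \o xsection (@cV_cons R n @^-1` E)).
  apply/funext => a /=; congr (bl n _).
  by apply/seteqP; split => v; rewrite /xsection/= inE.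
by apply; rewrite -[X in measurable X]setTI; exact: measurable_cV_cons.
Qed.

(** Cavalieri's principle: the slices with fixed first coordinate all scale by the same factor. *)
Lemma scales_skew_tail n (f : 'cV[R]_n.+1 -> 'cV[R]_n.+1) (t : R -> 'cV[R]_n -> 'cV[R]_n) c :
  measurable_fun setT f -> 0 <= c -> (forall a, scales (t a) c) ->
  (forall a v, f (cV_cons (a : measurableTypeR R, v)) = cV_cons (a : measurableTypeR R, t a v)) ->
  scales f c.
Proof.
move=> mf c0 st ft; split=> // E mE; rewrite !borel_lebesgue_xsection -ge0_integralZl//=.
- apply: eq_integral => a _; rewrite -(st a).2; last exact: measurable_section.
  by congr (bl n _); apply/seteqP; split => v /=; rewrite ft.
- exact: measurable_borel_lebesgue_section.
Qed.

Lemma measurable_lam_section n (E : set 'cV[R]_n.+1) : measurable E ->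
  measurable_fun setT (fun v : 'cV[R]_n => lam [set a | E (cV_cons (a, v))]).
Proof.
move=> mE; have := @measurable_fun_ysection _ _ (measurableTypeR R) 'cV[R]_n R lam (@cV_cons R n
    @^-1` E).
have -> : (fun v : 'cV[R]_n => lam [set a | E (cV_cons (a, v))]) =
   (lam \o ysection (@cV_cons R n @^-1` E)).
  apply/funext => v /=; congr (lam _).
  by apply/seteqP; split => a; rewrite /ysection/= inE.
by apply; rewrite -[X in measurable X]setTI; exact: measurable_cV_cons.
Qed.

Lemma scales_skew_head n (f : 'cV[R]_n.+1 -> 'cV[R]_n.+1) (t : 'cV[R]_n -> R -> R) c :
  measurable_fun setT f -> 0 <= c ->
  (forall v (A : set (measurableTypeR R)), measurable A -> lam (t v @^-1` A) = (c%:E * lam A)%E) ->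
  (forall a v, f (cV_cons (a : measurableTypeR R, v)) = cV_cons (t v a : measurableTypeR R, v)) ->
  scales f c.
Proof.
move=> mf c0 st ft; split=> // E mE.
rewrite !borel_lebesgue_ysection//; last by rewrite -[X in measurable X]setTI; exact: mf.
rewrite -ge0_integralZl//=.
- apply: eq_integral => v _; rewrite -(st v); last exact: measurable_section2.
  by congr (lam _); apply/seteqP; split => a /=; rewrite ft.
- exact: measurable_lam_section.
Qed.

Lemma cV_consD n (a b : R) (u w : 'cV[R]_n) :
  cV_cons (a : measurableTypeR R, u) + cV_cons (b : measurableTypeR R, w) =
  cV_cons ((a + b : R) : measurableTypeR R, u + w).
Proof.
by rewrite /cV_cons/= raddfD; exact: (@add_col_mx _ 1 n 1).
Qed.

Lemma scales_shift n (v : 'cV[R]_n) : scales (fun x => x + v) 1.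
Proof.
elim: n v => [|n IHn] v.
  split; first exact: measurable_addmx.
  move=> E _; rewrite mul1e; congr (bl 0 _).
  by apply/seteqP; split => x /=; rewrite [x + v](_ : _ = x)//; apply/colP => -[].
pose w : 'cV[R]_n := \col_i v (lift 0 i) 0.
have -> : (fun x => x + v) = (fun x => x + cV_cons (v 0 0 : measurableTypeR R, 0)) \o
    (fun x => x + cV_cons (0 : measurableTypeR R, w)).
  apply/funext => x /=; rewrite -addrA; congr (_ + _).
  apply/colP => i; rewrite !mxE; case: splitP => j ij; rewrite !mxE.
    rewrite ord1/= mulr1n add0r; congr (v _ _); apply/val_inj.
    by rewrite /= ij ord1.
  by rewrite addr0; congr (v _ _); apply/val_inj; rewrite /= ij.
rewrite -[1]mulr1; apply: scales_comp.
- apply: (@scales_skew_head _ _ (fun _ a => a + v 0 0)) => //.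
  + exact: measurable_addmx.
  + by move=> _ A mA; rewrite mul1e lebesgue_measure_shift.
  + by move=> a u; rewrite cV_consD addr0.
- apply: (@scales_skew_tail _ _ (fun _ u => u + w)) => //.
  + exact: measurable_addmx.
  + by move=> a u; rewrite cV_consD addr0.
Qed.

(** For a fixed first coordinate [a], the remaining coordinates are merely shifted by [a *: v]. *)
Lemma scales_lower n (v : 'cV[R]_n) :
  scales (mulmx (block_mx 1%:M 0 v 1%:M : 'M[R]_(1 + n))) 1.
Proof.
apply: (@scales_skew_tail _ _ (fun a u => u + a *: v)) => //.
- exact: measurable_mulmx.
- by move=> a; exact: scales_shift.
- move=> a u; rewrite /cV_cons/= mul_block_col !mul1mx mul0mx addr0.
  by rewrite mul_mx_scalar addrC.
Qed.

Lemma scales_upper n (w : 'rV[R]_n) :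
  scales (mulmx (block_mx 1%:M w 0 1%:M : 'M[R]_(1 + n))) 1.
Proof.
apply: (@scales_skew_head _ _ (fun u a => a + (w *m u) 0 0)) => //.
- exact: measurable_mulmx.
- by move=> u A mA; rewrite mul1e lebesgue_measure_shift.
- move=> a u; rewrite /cV_cons/= mul_block_col !mul1mx mul0mx add0r raddfD/=.
  by rewrite -mx11_scalar.
Qed.

Lemma scales_diag n (A : 'M[R]_n) c : 0 <= c -> scales (mulmx A) c ->
  scales (mulmx (block_mx 1%:M 0 0 A : 'M[R]_(1 + n))) c.
Proof.
move=> c0 sA; apply: (@scales_skew_tail _ _ (fun a u => A *m u)) => //.
- exact: measurable_mulmx.
- move=> a u; rewrite /cV_cons/= mul_block_col !mul1mx !mul0mx addr0 add0r.
  by [].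
Qed.

Lemma scales_homothety n (r : R) : 0 < r ->
  scales (fun x : 'cV[R]_n => r *: x) (r^-1 ^+ n).
Proof.
move=> r0.
have mZ m : measurable_fun setT (fun x : 'cV[R]_m => r *: x).
  rewrite (_ : (fun _ => _) = mulmx r%:M); first exact: measurable_mulmx.
  by apply/funext => x; rewrite mul_scalar_mx.
elim: n => [|n IHn].
  rewrite expr0; split; first exact: mZ.
  move=> E _; rewrite mul1e; congr (bl 0 _).
  by apply/seteqP; split => x /=; rewrite [r *: x](_ : _ = x)//; apply/colP => -[].
have mB (b c : R) : measurable_fun setT
   (mulmx (block_mx b%:M 0 0 c%:M : 'M[R]_(1 + n))) by exact: measurable_mulmx.
rewrite (_ : (fun _ => _) = mulmx (block_mx r%:M 0 0 1%:M : 'M[R]_(1 + n)) \o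
    mulmx (block_mx 1%:M 0 0 r%:M : 'M[R]_(1 + n))); last first.
  apply/funext => x; rewrite /= mulmxA mulmx_block !mulmx0 !mul0mx !mulmx1 !mul1mx.
  by rewrite !addr0 !add0r -scalar_mx_block mul_scalar_mx.
rewrite exprSr; apply: scales_comp.
- apply: (@scales_skew_head _ _ (fun _ a => r * a)); rewrite ?invr_ge0 ?ltW//.
    by move=> _ A mA; rewrite lebesgue_measure_scale.
  move=> a u; rewrite /cV_cons/= mul_block_col !mul1mx !mul0mx addr0 add0r.
  by rewrite mul_scalar_mx scale_scalar_mx.
- apply: (@scales_skew_tail _ _ (fun _ u => r *: u)) => //.
    by rewrite exprn_ge0// invr_ge0 ltW.
  move=> a u; rewrite /cV_cons/= mul_block_col !mul1mx !mul0mx addr0 add0r.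
  by rewrite mul_scalar_mx.
Qed.

Lemma scales_mulmx n (A B : 'M[R]_n) : scales (mulmx A) 1 -> scales (mulmx B) 1 ->
  scales (mulmx (A *m B)) 1.
Proof.
move=> sA sB; rewrite (_ : mulmx (A *m B) = mulmx A \o mulmx B).
  by rewrite -[1]mulr1; exact: scales_comp.
by apply/funext => x /=; rewrite mulmxA.
Qed.

(* Gaussian elimination: once the top left entry is 1, the matrix is the product
   of a unipotent lower, a block diagonal and a unipotent upper matrix. *)
Lemma scales_SL n (A : 'M[R]_n) : \det A = 1 -> scales (mulmx A) 1.
Proof.
elim: n A => [|n IHn] A detA.
  split; first exact: measurable_mulmx.
  move=> E _; rewrite mul1e; congr (bl 0 _).
  by apply/seteqP; split => x /=; rewrite [A *m x](_ : _ = x)//; apply/colP => -[].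
have key (B : 'M[R]_(1 + n)) : \det B = 1 -> B 0 0 = 1 -> scales (mulmx B) 1.
  move=> detB B00; have ulB : ulsubmx B = 1%:M.
    by rewrite [ulsubmx B]mx11_scalar !mxE lshift0 B00.
  have BE : B = (block_mx 1%:M 0 (dlsubmx B) 1%:M : 'M[R]_(1 + n)) *m
      ((block_mx 1%:M 0 0 (drsubmx B - dlsubmx B *m ursubmx B) : 'M[R]_(1 + n)) *m
      (block_mx 1%:M (ursubmx B) 0 1%:M : 'M[R]_(1 + n))).
    rewrite !mulmx_block !mulmx0 !mul0mx !mulmx1 !mul1mx !addr0 !add0r.
    by rewrite mulmx1 addrCA subrr addr0 -[LHS]submxK ulB.
  rewrite BE; apply: scales_mulmx; first exact: scales_lower.
  apply: scales_mulmx; last exact: scales_upper.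
  apply: scales_diag => //; apply: IHn.
  move: detB; rewrite {1}BE !det_mulmx !det_lblock det_ublock !det1.
  by rewrite !mul1r !mulr1.
have upper_inv (w : 'rV[R]_n) (B : 'M[R]_(1 + n)) :
   scales (mulmx ((block_mx 1%:M w 0 1%:M : 'M[R]_(1 + n)) *m B)) 1 -> scales (mulmx B) 1.
  move=> s; rewrite (_ : B = (block_mx 1%:M (- w) 0 1%:M : 'M[R]_(1 + n)) *m
    ((block_mx 1%:M w 0 1%:M : 'M[R]_(1 + n)) *m B)).
    by apply: scales_mulmx => //; exact: scales_upper.
  rewrite mulmxA mulmx_block !mulmx0 !mul0mx !mulmx1 !mul1mx !addr0 !add0r.
  by rewrite subrr -scalar_mx_block mul1mx.
have lower_inv (w : 'cV[R]_n) (B : 'M[R]_(1 + n)) :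
   scales (mulmx ((block_mx 1%:M 0 w 1%:M : 'M[R]_(1 + n)) *m B)) 1 -> scales (mulmx B) 1.
  move=> s; rewrite (_ : B = (block_mx 1%:M 0 (- w) 1%:M : 'M[R]_(1 + n)) *m
    ((block_mx 1%:M 0 w 1%:M : 'M[R]_(1 + n)) *m B)).
    by apply: scales_mulmx => //; exact: scales_lower.
  rewrite mulmxA mulmx_block !mulmx0 !mul0mx !mulmx1 !mul1mx !addr0 !add0r.
  by rewrite addNr -scalar_mx_block mul1mx.
have key2 (B : 'M[R]_(1 + n)) : \det B = 1 -> dlsubmx B != 0 -> scales (mulmx B) 1.
  move=> detB /cV0Pn[i Bi].
  (* Adding this multiple of the row that contains the nonzero entry to the top row turns the corner
     into 1. *)
  apply: (@upper_inv (((1 - B 0 0) / dlsubmx B i 0) *: delta_mx 0 i)); apply: key.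
    by rewrite det_mulmx det_ublock !det1 !mul1r.
  rewrite -[B in _ *m B]submxK mulmx_block !mul1mx.
  rewrite (_ : (0 : 'I_(1 + n)) = lshift n 0); last by apply/val_inj.
  rewrite block_mxEul !mxE lshift0 (bigD1 i)//= big1 ?addr0; last first.
    by move=> j /negPf ji; rewrite !mxE ji andbF mulr0 mul0r.
  by move: Bi; rewrite !mxE !eqxx !lshift0 mulr1 => Bi; rewrite divfK// addrC subrK.
have [A0|] := eqVneq (dlsubmx (A : 'M[R]_(1 + n))) 0; last exact: key2.
case: n => [|n] in A detA IHn key upper_inv lower_inv key2 A0 *.
  by apply: key => //; move: detA; rewrite det_mx11.
(* The first column vanishes below the corner. Adding the top row to the next one copies the corner
   there, and the corner is nonzero since otherwise the determinant would vanish. *)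
apply: (@lower_inv (delta_mx 0 0)); apply: key2.
  by rewrite det_mulmx det_lblock !det1 !mul1r.
rewrite -[A in _ *m A](@submxK _ 1 n.+1 1 n.+1) mulmx_block block_mxKdl A0.
rewrite mulmx0 addr0; apply/eqP => /matrixP/(_ 0 0); rewrite mxE big_ord1 mxE !eqxx mul1r mxE.
move=> A00; pose B : 'M[R]_(1 + n.+1) := A.
have : \det B = 0.
  rewrite -[B]submxK [dlsubmx B]A0 det_ublock [ulsubmx _]mx11_scalar.
  by rewrite det_scalar1; move: A00; rewrite !mxE => ->; rewrite mul0r.
by rewrite /B detA => /eqP; rewrite oner_eq0.
Qed.

End borel_linear.

(** * Passage to the completed measure *)

Section completed_lebesgue.
Context {R : realType}.
Local Notation lam := (@lebesgue_measure R).
Local Notation bl n := (@borel_lebesgue_cV R n).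
Local Notation LT n := (caratheodory_type (@borel_lebesgue_cV R n)^*%mu).
Local Notation leb n := (@lebesgue_cV R n).

Lemma measurable_borel_lebesgue n (E : set 'cV[R]_n) : measurable E ->
  measurable (E : set (LT n)).
Proof. by move=> mE; exact: (caratheodory_measurable_mu_ext (bl n)). Qed.

Lemma lebesgue_cV_borel n (E : set 'cV[R]_n) : measurable E ->
  leb n E = bl n E.
Proof. by move=> mE; exact: (measurable_mu_extE (bl n)). Qed.

Lemma measurable_fun_borel_lebesgue n d (T : measurableType d) (f : 'cV[R]_n -> T) :
  measurable_fun [set: 'cV[R]_n] f -> measurable_fun [set: LT n] f.
Proof.
move=> mf _ Y mY; apply: measurable_borel_lebesgue.
by apply: mf.
Qed.

(** A countable Borel cover of [X] pulls back to a cover of the preimage with total mass multiplied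
    by [c]. No measurability of [X] is involved, so the same bound for the inverse map yields
    equality on all sets. *)
Lemma mu_ext_scales_le n (f : 'cV[R]_n -> 'cV[R]_n) c : 0 < c ->
  scales f c -> forall X, ((bl n)^*%mu (f @^-1` X) <= c%:E * (bl n)^*%mu X)%E.
Proof.
move=> c0 [mf sf] X; rewrite -lee_pdivrMl//; apply: le_ereal_inf_tmp => _ [F [mF XF] <-].
rewrite lee_pdivrMl// -nneseriesZl//.
rewrite (eq_eseriesr (fun i _ => esym (sf (F i) (mF i)))).
apply: ereal_inf_lbound; exists (fun i => f @^-1` F i) => //; split.
  by move=> i; rewrite -[X in measurable X]setTI; exact: mf.
by rewrite -preimage_bigcup; exact: preimage_subset.
Qed.

Lemma mu_ext_scales n (f g : 'cV[R]_n -> 'cV[R]_n) c : 0 < c ->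
  scales f c -> scales g c^-1 -> cancel g f ->
  forall X, (bl n)^*%mu (f @^-1` X) = (c%:E * (bl n)^*%mu X)%E.
Proof.
move=> c0 sf sg gf X; apply/eqP; rewrite eq_le mu_ext_scales_le//=.
rewrite -lee_pdivlMl//.
have := mu_ext_scales_le _ sg (f @^-1` X); rewrite invr_gt0 => /(_ c0).
by rewrite -comp_preimage (_ : f \o g = idfun) ?preimage_id//; exact/funext.
Qed.

(** Every test set in the Caratheodory criterion is itself a preimage under [f], so the criterion
    for [X] transports, both sides being multiplied by [c]. *)
Lemma measurable_scales_lebesgue n (f g : 'cV[R]_n -> 'cV[R]_n) c : 0 < c ->
  scales f c -> scales g c^-1 -> cancel f g -> cancel g f ->
  measurable_fun [set: LT n] (f : LT n -> LT n).
Proof.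
move=> c0 sf sg fg gf _ /= X mX; rewrite setTI.
have {}mX Z : (bl n)^*%mu Z = ((bl n)^*%mu (Z `&` X) + (bl n)^*%mu (Z `&` ~` X))%E.
  exact: mX.
suff sX Y : (bl n)^*%mu Y = ((bl n)^*%mu (Y `&` f @^-1` X) +
  (bl n)^*%mu (Y `&` ~` (f @^-1` X)))%E by exact: sX.
have -> : Y = f @^-1` (g @^-1` Y).
  by rewrite -comp_preimage (_ : g \o f = idfun) ?preimage_id//; exact/funext.
rewrite preimage_setC -!preimage_setI !(mu_ext_scales c0 sf sg gf).
by rewrite (mX (g @^-1` Y)) ge0_muleDr// outer_measure_ge0.
Qed.

Lemma lebesgue_cV_scales n (f g : 'cV[R]_n -> 'cV[R]_n) c : 0 < c ->
  scales f c -> scales g c^-1 -> cancel g f ->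
  forall X, leb n (f @^-1` X) = (c%:E * leb n X)%E.
Proof. exact: mu_ext_scales. Qed.

Lemma unitmx_det1 n (A : 'M[R]_n) : \det A = 1 -> A \in unitmx.
Proof. by rewrite unitmxE => ->; rewrite unitr1. Qed.

Lemma det_invmx1 n (A : 'M[R]_n) : \det A = 1 -> \det (invmx A) = 1.
Proof. by rewrite det_inv => ->; rewrite invr1. Qed.

Section SL.
Context n (A : 'M[R]_n) (detA : \det A = 1).

Let AK : cancel (mulmx A : 'cV[R]_n -> 'cV[R]_n) (mulmx (invmx A)).
Proof. by move=> x; rewrite mulKmx// unitmx_det1. Qed.

Let KA : cancel (mulmx (invmx A) : 'cV[R]_n -> 'cV[R]_n) (mulmx A).
Proof. by move=> x; rewrite mulKVmx// unitmx_det1. Qed.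

Let sA : scales (mulmx A) 1. Proof. exact: scales_SL. Qed.

Let sVA : scales (mulmx (invmx A)) 1^-1.
Proof. by rewrite invr1; apply: scales_SL; exact: det_invmx1. Qed.

Lemma measurable_SL : measurable_fun [set: LT n] (mulmx A : LT n -> LT n).
Proof. exact: measurable_scales_lebesgue sA sVA AK KA. Qed.

Lemma lebesgue_cV_SL (X : set (LT n)) : leb n (mulmx A @^-1` X) = leb n X.
Proof. by rewrite (lebesgue_cV_scales ltr01 sA sVA KA) mul1e. Qed.

End SL.

Lemma cV_cons_ord0 n (a : R) (v : 'cV[R]_n) :
  cV_cons (a : measurableTypeR R, v) ord0 0 = a.
Proof. by have := cV_consK (a : measurableTypeR R, v) => -[]. Qed.

Lemma cV_cons_lift n (a : R) (v : 'cV[R]_n) j :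
  cV_cons (a : measurableTypeR R, v) (lift ord0 j) 0 = v j 0.
Proof.
by have := cV_consK (a : measurableTypeR R, v) => -[_ /colP/(_ j)]; rewrite mxE.
Qed.

Lemma borel_hyperplane0 n (i : 'I_n) (a : R) : bl n [set x | x i 0 = a] = 0%E.
Proof.
have mH m (j : 'I_m) : measurable [set x : 'cV[R]_m | x j 0 = a].
  rewrite -[X in measurable X]setTI.
  exact: (@measurable_cV_coord R m j measurableT [set a]).
elim: n i => [[]//|n IHn] i.
have [j|] := unliftP ord0 i => ->.
  rewrite borel_lebesgue_xsection integral0_eq// => b _; rewrite -[RHS](IHn j); congr (bl n _).
  by apply/seteqP; split => v; rewrite /mkset cV_cons_lift.
rewrite borel_lebesgue_ysection; last exact: mH.
rewrite integral0_eq// => v _; rewrite -[RHS](lebesgue_measure_set1 a).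
by congr (lam _); apply/seteqP; split => b; rewrite /mkset cV_cons_ord0.
Qed.

Definition cube n (a b : R) : set 'cV[R]_n := [set x | forall i, a < x i 0 <= b].
Arguments cube : clear implicits.

Lemma measurable_cube n a b : measurable (cube n a b).
Proof.
rewrite (_ : cube n a b = \bigcap_(i in [set: 'I_n]) (cV_coord i @^-1` `]a, b]%classic)).
  apply: fin_bigcap_measurable => // i _; rewrite -[X in measurable X]setTI.
  exact: measurable_cV_coord.
apply/seteqP; split => [x xab i _|x xab i]; first by rewrite /= in_itv /cV_coord/= xab.
by have := xab i I; rewrite /= in_itv.
Qed.

Lemma borel_cube n a b : a <= b -> bl n (cube n a b) = ((b - a) ^+ n)%:E.
Proof.
move=> ab; elim: n => [|n IHn].
  rewrite [LHS]/= diracE mem_set//=; by case.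
rewrite [LHS]/= /cV_cons_measure /pushforward.
rewrite (_ : _ @^-1` _ = `]a, b]%classic `*` cube n a b); last first.
  apply/seteqP; split => [[y v] /= yv|[y v] /= [yab vab] i].
    split=> /=; first by rewrite in_itv/=; have := yv ord0; rewrite cV_cons_ord0.
    by move=> i; have := yv (lift ord0 i); rewrite cV_cons_lift.
  have [j|] := unliftP ord0 i => ->; first by rewrite cV_cons_lift.
  by rewrite cV_cons_ord0; move: yab; rewrite in_itv.
rewrite product_measure1E//; last exact: measurable_cube.
transitivity (lam `]a, b]%classic * bl n (cube n a b))%E => //.
rewrite IHn lebesgue_measure_itv/= lte_fin exprS EFinM.
have [ab'|] := ltP a b; first by rewrite EFinB.
by move=> ba; have -> : a = b by [apply/le_anti/andP; split]; rewrite subrr mul0e.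
Qed.

(** Intersect Borel covers whose measure exceeds that of [E] by at most 1/(k+1). Finiteness permits
    subtracting the measure of [E]. This carries the vanishing of a charge from Borel to Lebesgue
    measurable sets. *)
Lemma borel_hull n (E : set (LT n)) : measurable E -> (leb n E < +oo)%E ->
  exists F : set 'cV[R]_n, [/\ measurable F, E `<=` F & leb n (F `\` E) = 0%E].
Proof.
move=> mE Eoo.
have h k : exists F : set 'cV[R]_n, [/\ measurable F, E `<=` F &
   (leb n F <= leb n E + k.+1%:R^-1%:E)%E].
  have e0 : 0 < k.+1%:R^-1 :> R by rewrite invr_gt0.
  have Efin : ereal_inf [set (\sum_(0 <= k <oo) bl n (A k))%E | A in measurable_cover (E : set
      'cV[R]_n)]
     \is a fin_num.
    by rewrite -[X in X \is a fin_num]/(leb n E) ge0_fin_numE//.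
  have [_ [F [mF EF] <-] ltF] := lb_ereal_inf_adherent e0 Efin.
  have mU : measurable (\bigcup_i F i : set 'cV[R]_n) by exact: bigcupT_measurable.
  exists (\bigcup_i F i); split => //.
  rewrite (lebesgue_cV_borel mU) (le_trans _ (ltW ltF))//.
  by apply: measure_sigma_subadditive.
pose F k := projT1 (cid (h k)).
have FP k : [/\ measurable (F k), E `<=` F k & (leb n (F k) <= leb n E + k.+1%:R^-1%:E)%E].
  exact: projT2 (cid (h k)).
have mI : measurable (\bigcap_k F k).
  by apply: bigcapT_measurable => k; have [] := FP k.
have EI : E `<=` \bigcap_k F k by move=> x Ex k _; have [_ /(_ _ Ex)] := FP k.
exists (\bigcap_k F k); split=> //.
have mI' := measurable_borel_lebesgue mI.
have IE : (leb n (\bigcap_k F k) <= leb n E)%E.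
  apply/lee_addgt0Pr => e e0.
  near \oo => k.
  have [mF EF /le_trans leF] := FP k.
  apply: (@le_trans _ _ (leb n (F k))).
    apply: le_measure; rewrite ?inE//; first exact: measurable_borel_lebesgue.
    exact: bigcap_inf.
  apply: leF; rewrite leeD2l// lee_fin; apply/ltW.
  by near: k; exact: near_infty_natSinv_lt (PosNum e0).
have : (leb n (\bigcap_k F k) = leb n E + leb n (\bigcap_k F k `\` E))%E.
  rewrite -measureU//; last 2 first.
  - exact: measurableD.
  - exact: setDIK.
  by congr (leb n _); rewrite setDUK.
move=> IEE; move: IE; rewrite IEE -leeBrDl// ?subee; last 2 first.
- by rewrite ge0_fin_numE.
- by rewrite ge0_fin_numE.
by move=> D0; apply/eqP; rewrite eq_le D0 measure_ge0.
Unshelve. all: by end_near. Qed.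

End completed_lebesgue.

(** * Functions in L^p(|x|^2 dx) *)

Section Lp_basics.
Context {R : realType}.
Local Notation LT n := (caratheodory_type (@borel_lebesgue_cV R n)^*%mu).
Local Notation leb n := (@lebesgue_cV R n).

Lemma enorm_sqr n (x : 'cV[R]_n) : enorm x ^+ 2 = \sum_(i < n) x i 0 ^+ 2.
Proof. by rewrite sqr_sqrtr// sumr_ge0// => i _; exact: sqr_ge0. Qed.

Lemma enorm_ge0 n (x : 'cV[R]_n) : 0 <= enorm x.
Proof. exact: sqrtr_ge0. Qed.

Lemma coord_le_enorm n (x : 'cV[R]_n) i : `|x i 0| <= enorm x.
Proof.
rewrite -(@ler_pXn2r _ 2)// ?nnegrE ?enorm_ge0// enorm_sqr real_normK ?num_real//.
by rewrite (bigD1 i)//= lerDl sumr_ge0// => j _; exact: sqr_ge0.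
Qed.

Lemma coord_mul_le_enorm n (x : 'cV[R]_n) i j : `|x i 0 * x j 0| <= enorm x ^+ 2.
Proof. by rewrite normrM expr2 ler_pM// coord_le_enorm. Qed.

Lemma enorm_mulmx n (A : 'M[R]_n) :
  exists2 C : R, 0 <= C & forall x : 'cV[R]_n, enorm (A *m x) ^+ 2 <= C * enorm x ^+ 2.
Proof.
pose S i := \sum_j `|A i j|; exists (\sum_i S i ^+ 2).
  by apply: sumr_ge0 => i _; exact: sqr_ge0.
move=> x; rewrite enorm_sqr mulr_suml; apply: ler_sum => i _.
have S0 : 0 <= S i by exact: sumr_ge0.
rewrite -exprMn -[leLHS]real_normK ?num_real// ler_pXn2r ?nnegrE ?mulr_ge0 ?enorm_ge0//.
rewrite mxE (le_trans (ler_norm_sum _ _ _))// mulr_suml; apply: ler_sum => j _.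
by rewrite normrM ler_wpM2l ?coord_le_enorm.
Qed.

Lemma measurable_coord_lebesgue n (i : 'I_n) :
  measurable_fun [set: LT n] (fun x : LT n => (x : 'cV[R]_n) i 0).
Proof. exact: (measurable_fun_borel_lebesgue (measurable_cV_coord i)). Qed.

Lemma measurable_enorm2 n :
  measurable_fun [set: LT n] (fun x : LT n => enorm (x : 'cV[R]_n) ^+ 2).
Proof.
rewrite (_ : (fun _ => _) = fun x : LT n => \sum_(i < n) (x : 'cV[R]_n) i 0 ^+ 2).
  apply: measurable_sum => i; apply: measurable_funX.
  exact: measurable_coord_lebesgue.
by apply/funext => x; exact: enorm_sqr.
Qed.

Lemma measurable_Lp_integrand (p : R) n (h : 'cV[R]_n -> R) : lebesgue_measurable h ->
  measurable_fun [set: LT n] (fun x : LT n => `|h x| `^ p * enorm (x : 'cV[R]_n) ^+ 2).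
Proof.
move=> mh; apply: measurable_funM; last exact: measurable_enorm2.
apply: (measurableT_comp (measurable_powR p)).
exact: measurableT_comp.
Qed.

Lemma Lp_integral_ge0 (p : R) n (h : 'cV[R]_n -> R) : (0 <= Lp_integral p h)%E.
Proof.
by apply: integral_ge0 => x _; rewrite lee_fin mulr_ge0 ?powR_ge0// sqr_ge0.
Qed.

Lemma Lp_integrable (p : R) n (h : 'cV[R]_n -> R) : Lp p h ->
  (leb n).-integrable [set: LT n] (fun x : LT n => (`|h x| `^ p * enorm (x : 'cV[R]_n) ^+ 2)%:E).
Proof.
move=> [mh hoo]; apply/integrableP; split.
  exact/measurable_EFinP/measurable_Lp_integrand.
rewrite (eq_integral (fun x : LT n => (`|h x| `^ p * enorm (x : 'cV[R]_n) ^+ 2)%:E))// => x _.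
by rewrite gee0_abs// lee_fin mulr_ge0 ?powR_ge0// sqr_ge0.
Qed.

Lemma Lp_dom (p : R) n (g h f : 'cV[R]_n -> R) c : lebesgue_measurable g -> Lp p h -> Lp p f ->
  (forall x, `|g x| `^ p <= c * (`|h x| `^ p + `|f x| `^ p)) -> Lp p g.
Proof.
move=> mg Lh Lf gle; split=> //.
have int := integrableZl measurableT c (integrableD measurableT (Lp_integrable Lh) (Lp_integrable
    Lf)).
apply: integrable_lty => //.
apply: le_integrable int => //.
  exact/measurable_EFinP/measurable_Lp_integrand.
move=> x _ /=; rewrite lee_fin -mulrDl; move: (enorm _ ^+ 2) => w.
rewrite mulrA !(normrM _ w) ler_wpM2r// ger0_norm ?powR_ge0//.
by rewrite (le_trans (gle _))// ler_norm.
Qed.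

Lemma lebesgue_measurable_cst n (c : R) : lebesgue_measurable (fun _ : 'cV[R]_n => c).
Proof. exact: measurable_cst. Qed.

Lemma Lp_0 (p : R) n : 0 < p -> Lp p (fun _ : 'cV[R]_n => 0).
Proof.
move=> p0; split; first exact: lebesgue_measurable_cst.
rewrite /Lp_integral integral0_eq// => x _.
by rewrite normr0 powR0 ?gt_eqF// mul0r.
Qed.

Lemma Lp_dom1 (p : R) n (g h : 'cV[R]_n -> R) : 0 < p -> lebesgue_measurable g -> Lp p h ->
  (forall x, `|g x| <= `|h x|) -> Lp p g.
Proof.
move=> p0 mg Lh gh; apply: (Lp_dom (c := 1) mg Lh (Lp_0 _ p0)) => x.
rewrite mul1r normr0 powR0 ?gt_eqF// addr0.
by apply: ge0_ler_powR; rewrite ?nnegrE// ltW.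
Qed.

Lemma Lp_max (p : R) n (h f : 'cV[R]_n -> R) : 0 < p -> Lp p h -> Lp p f ->
  Lp p (fun x => Num.max (h x) (f x)).
Proof.
move=> p0 Lh Lf; apply: (Lp_dom (c := 1) _ Lh Lf).
  by apply: measurable_maxr; [exact: Lh.1|exact: Lf.1].
move=> x; rewrite mul1r; case: (leP (h x) (f x)) => _.
  by rewrite lerDr powR_ge0.
by rewrite lerDl powR_ge0.
Qed.

Lemma Lp_min (p : R) n (h f : 'cV[R]_n -> R) : 0 < p -> Lp p h -> Lp p f ->
  Lp p (fun x => Num.min (h x) (f x)).
Proof.
move=> p0 Lh Lf; apply: (Lp_dom (c := 1) _ Lh Lf).
  by apply: measurable_minr; [exact: Lh.1|exact: Lf.1].
move=> x; rewrite mul1r; case: (leP (h x) (f x)) => _.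
  by rewrite lerDl powR_ge0.
by rewrite lerDr powR_ge0.
Qed.

Lemma cvg_powR0 (u : R^nat) r : 0 < r -> (forall k, 0 <= u k) ->
  u k @[k --> \oo] --> (0 : R) -> u k `^ r @[k --> \oo] --> (0 : R).
Proof.
move=> r0 u0 uc; apply/cvgr0Pnorm_lt => e e0.
have er0 : 0 < e `^ r^-1 by rewrite powR_gt0.
near=> k; rewrite ger0_norm ?powR_ge0//.
have -> : e = (e `^ r^-1) `^ r by rewrite -powRrM mulVf ?powRr1 ?gt_eqF// ltW.
apply: gt0_ltr_powR; rewrite ?nnegrE ?powR_ge0//.
rewrite -[u k]ger0_norm//.
by near: k; exact: cvgr0_norm_lt.
Unshelve. all: by end_near. Qed.

Lemma cvg_poweR0 (u : (\bar R)^nat) r : 0 < r -> (forall k, 0 <= u k)%E ->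
  (u k @[k --> \oo] --> 0)%E -> (u k `^ r @[k --> \oo] --> 0)%E.
Proof.
move=> r0 u0 /fine_cvgP[ufin uc]; apply/fine_cvgP; split.
  near=> k; apply: fin_num_poweR; by near: k.
rewrite [_ \o _](_ : _ = fun k => fine (u k) `^ r).
  by apply: cvg_powR0 => // k; exact: fine_ge0.
by apply/funext => k /=; rewrite fine_poweR.
Unshelve. all: by end_near. Qed.

Lemma Lp_norm_cvg0 (p : R) n (h_ : ('cV[R]_n -> R)^nat) : 0 < p ->
  (Lp_norm p (h_ k) @[k --> \oo] --> 0)%E <-> (Lp_integral p (h_ k) @[k --> \oo] --> 0)%E.
Proof.
move=> p0; split => h.
  rewrite (_ : (fun _ => _) = fun k => Lp_norm p (h_ k) `^ p)%E.
    by apply: cvg_poweR0 => // k; exact: poweR_ge0.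
  apply/funext => k; rewrite -poweRrM mulVf ?gt_eqF// poweRe1//.
  exact: Lp_integral_ge0.
by apply: cvg_poweR0; rewrite ?invr_gt0// => k; exact: Lp_integral_ge0.
Qed.

Lemma Lp_cvg0_dominated (p : R) n (g_ : ('cV[R]_n -> R)^nat) (G : 'cV[R]_n -> R) :
  0 < p -> (forall k, lebesgue_measurable (g_ k)) -> Lp p G ->
  (forall k x, `|g_ k x| <= `|G x|) -> (forall x, g_ k x @[k --> \oo] --> (0 : R)) ->
  (Lp_integral p (g_ k) @[k --> \oo] --> 0)%E.
Proof.
move=> p0 mg LG gG g0.
have := @dominated_cvg _ _ _ (leb n) setT measurableT
  (fun k (x : LT n) => (`|g_ k x| `^ p * enorm (x : 'cV[R]_n) ^+ 2)%:E) (cst 0)%E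
  (fun x : LT n => (`|G x| `^ p * enorm (x : 'cV[R]_n) ^+ 2)%:E).
rewrite integral0; apply => //.
- by move=> k; exact/measurable_EFinP/measurable_Lp_integrand.
- move=> x _; apply/fine_cvgP; split; first by apply: nearW => k.
  have u0 : `|g_ k x| `^ p @[k --> \oo] --> (0 : R).
    by apply: cvg_powR0 => //; exact/norm_cvg0P.
  have := cvgMr_tmp (b := enorm (x : 'cV[R]_n) ^+ 2) u0.
  rewrite mul0r; exact.
- exact: Lp_integrable.
- move=> k x _; rewrite gee0_abs ?lee_fin ?(mulr_ge0 (powR_ge0 _ _) (sqr_ge0 _))//.
  by rewrite ler_wpM2r ?sqr_ge0//; apply: ge0_ler_powR; rewrite ?nnegrE// ltW.
Qed.

Lemma lebesgue_measurable_SL n (A : 'M[R]_n) (h : 'cV[R]_n -> R) : \det A = 1 ->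
  lebesgue_measurable h -> lebesgue_measurable (fun x => h (A *m x)).
Proof.
move=> detA mh; exact: (measurableT_comp mh (measurable_SL detA)).
Qed.

Lemma integral_SL n (A : 'M[R]_n) (f : LT n -> \bar R) : \det A = 1 ->
  measurable_fun [set: LT n] f -> (forall x, 0 <= f x)%E ->
  (\int[leb n]_x f (A *m (x : 'cV[R]_n) : LT n) = \int[leb n]_x f x)%E.
Proof.
move=> detA mf f0.
have := @ge0_integral_pushforward _ _ _ _ R _ (measurable_SL detA) (leb n) setT f.
rewrite preimage_setT => <- //.
apply: eq_measure_integral => [|mA X mX _]; first exact: measurable_SL.
exact: lebesgue_cV_SL.
Qed.

Lemma integrable_SL n (A : 'M[R]_n) (f : LT n -> \bar R) : \det A = 1 ->
  (leb n).-integrable [set: LT n] f ->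
  (leb n).-integrable [set: LT n] (fun x => f (A *m (x : 'cV[R]_n) : LT n)).
Proof.
move=> detA /integrableP[mf foo]; apply/integrableP; split.
  exact: (measurableT_comp mf (measurable_SL detA)).
by rewrite (integral_SL (f := fun x => `|f x|%E) detA)//; exact: measurableT_comp.
Qed.

Lemma Rintegral_SL n (A : 'M[R]_n) (f : LT n -> R) : \det A = 1 ->
  (leb n).-integrable [set: LT n] (EFin \o f) ->
  \int[leb n]_x f (A *m (x : 'cV[R]_n) : LT n) = \int[leb n]_x f x.
Proof.
move=> detA int; have /integrableP[mf _] := int; rewrite /Rintegral; congr fine.
have := @integral_pushforward _ _ _ _ R _ (measurable_SL detA) (leb n) setT (EFin \o f) mf.
rewrite preimage_setT => <- //; last exact: integrable_SL.
apply: eq_measure_integral => [|mA X mX _]; first exact: measurable_SL.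
exact: lebesgue_cV_SL.
Qed.

(** The weight is not SL(n) invariant, but x = A^-1 (A x) gives |x|^2 <= C |A x|^2, and the
    resulting majorant is the composition of an integrable function with A. *)
Lemma Lp_SL (p : R) n (h : 'cV[R]_n -> R) (A : 'M[R]_n) : 0 < p -> \det A = 1 -> Lp p h ->
  Lp p (fun x => h (A *m x)).
Proof.
move=> p0 detA Lh; have [mh hoo] := Lh; split; first exact: lebesgue_measurable_SL.
have [C C0 CP] := enorm_mulmx (invmx A).
have int := integrableZl measurableT C (integrable_SL detA (Lp_integrable Lh)).
apply: integrable_lty => //; apply: le_integrable int => //.
  by apply/measurable_EFinP/measurable_Lp_integrand; exact: lebesgue_measurable_SL.
move=> x _; rewrite /= lee_fin.
rewrite [X in X <= _](ger0_norm (mulr_ge0 (powR_ge0 _ _) (sqr_ge0 _))).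
apply: le_trans (ler_norm _); rewrite [leRHS]mulrCA ler_wpM2l ?powR_ge0//.
by have := CP (A *m x); rewrite mulKmx ?unitmx_det1.
Qed.

End Lp_basics.

(** * The moment matrix as a continuous covariant valuation *)

Section growth.
Context {R : realType}.
Implicit Types (p : R) (xi : R -> R).

Lemma powR_add_le p (a b : R) : 0 < p -> 0 <= a -> 0 <= b ->
  (a + b) `^ p <= 2 `^ p * (a `^ p + b `^ p).
Proof.
move=> p0 a0 b0; have mono (x y : R) : 0 <= x -> x <= y -> x `^ p <= y `^ p.
  by move=> x0 xy; apply: ge0_ler_powR; rewrite ?nnegrE ?(ltW p0)// (le_trans x0).
have [ab|/ltW ba] := leP a b.
  apply: (@le_trans _ _ ((2 * b) `^ p)); first by apply: mono; [exact: addr_ge0|lra].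
  by rewrite powRM// ler_wpM2l ?powR_ge0// lerDr powR_ge0.
apply: (@le_trans _ _ ((2 * a) `^ p)); first by apply: mono; [exact: addr_ge0|lra].
by rewrite powRM// ler_wpM2l ?powR_ge0// lerDl powR_ge0.
Qed.

(** Bound both values by growth and |s|^p by 2^p (|t|^p + |s - t|^p); the additional 1 in the
    constant accounts for xi(t). *)
Lemma Atilde_dist_le p xi : 0 < p -> Atilde p xi ->
  exists2 C : R, 0 <= C & forall s t, `|xi s - xi t| <= C * (`|t| `^ p + `|s - t| `^ p).
Proof.
move=> p0 [cxi [d xid]].
have d0 : 0 <= d.
  by have := le_trans (normr_ge0 _) (xid 1); rewrite normr1 powR1 mulr1.
have t0 : 0 <= 2 `^ p :> R by exact: powR_ge0.
exists (d * (2 `^ p + 1)); first by rewrite mulr_ge0// addr_ge0.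
move=> s t; apply: le_trans (ler_normB _ _) _.
have sp : `|s| `^ p <= 2 `^ p * (`|t| `^ p + `|s - t| `^ p).
  apply: le_trans (powR_add_le p0 _ _) => //.
  apply: ge0_ler_powR; rewrite ?nnegrE ?(ltW p0)// ?addr_ge0//.
  by rewrite -{1}(subrK t s) addrC ler_normD.
apply: (le_trans (lerD (xid s) (xid t))).
rewrite -mulrDr -mulrA ler_wpM2l// mulrDl mul1r.
by rewrite lerD// lerDl powR_ge0.
Qed.

(** Only [t] is confined to the segment while [s] may leave it, so uniform continuity on the segment
    itself would not suffice; compactness is applied to a statement about [t] alone. *)
Lemma heine_itv (xi : R -> R) (a b e : R) : continuous xi -> 0 < e ->
  exists2 d : R, 0 < d & forall s t, t \in `[a, b] -> `|s - t| <= d -> `|xi s - xi t| <= e.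
Proof.
move=> cxi e0; have := @segment_compact R a b.
move=> /compact_near_coveringP/(_ R (0 : R)^'+
  (fun d t => forall s, `|s - t| <= d -> `|xi s - xi t| <= e)) H.
have {}H : \forall d \near (0 : R)^'+, `[a, b]%classic `<=`
    [set t | forall s, `|s - t| <= d -> `|xi s - xi t| <= e].
  apply: H => t0 _.
  have e2 : 0 < e / 2 by rewrite divr_gt0.
  have /cvgrPdist_lt/(_ _ e2)/nbhs_ballP[r /= r0 rP] := cxi t0.
  exists (ball t0 (r / 2), [set d | d < r / 2]) => /=.
    split; first by apply: nbhsx_ballx; rewrite divr_gt0.
    by apply: nbhs_right_lt; rewrite divr_gt0.
  move=> [t d]/= [t0t dr] s std.
  have h1 : `|xi t0 - xi t| < e / 2.
    by apply: rP; apply: le_ball t0t; rewrite ler_pdivrMr// ler_pMr// ler1n.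
  have h2 : `|xi t0 - xi s| < e / 2.
    apply: rP; rewrite /ball/= -(subrK t t0) -addrA (le_lt_trans (ler_normD _ _))//.
    by rewrite (splitr r) ltrD// distrC (le_lt_trans std).
  rewrite -(subrK (xi t0) (xi s)) -addrA (le_trans (ler_normD _ _))//.
  by rewrite (splitr e) lerD// ltW// distrC.
near (0 : R)^'+ => d.
exists d; first by near: d; exact: nbhs_right_gt.
move=> s t tab; have : `[a, b]%classic `<=` [set t | forall s, `|s - t| <= d -> `|xi s - xi t| <=
    e].
  by near: d.
by move=> /(_ t tab s).
Unshelve. all: by end_near. Qed.

(** If s is close to t, uniform continuity gives an error below e (N+1)^-p <= e |t|^p. Otherwise |s
    - t| >= d, and |t|^p <= (N+1)^p is absorbed into a multiple of |s - t|^p. *)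
Lemma Atilde_unif p xi N e : 0 < p -> Atilde p xi -> 0 < e ->
  exists2 C : R, 0 <= C & forall s t, N.+1%:R^-1 <= `|t| <= N.+1%:R ->
    `|xi s - xi t| <= e * `|t| `^ p + C * `|s - t| `^ p.
Proof.
move=> p0 Axi e0; have [C0 C00 C0P] := Atilde_dist_le p0 Axi.
have mono (x y : R) : 0 <= x -> x <= y -> x `^ p <= y `^ p.
  by move=> x0 xy; apply: ge0_ler_powR; rewrite ?nnegrE ?(ltW p0)// (le_trans x0).
have N0 : 0 < N.+1%:R^-1 :> R by rewrite invr_gt0.
have eN0 : 0 < e * N.+1%:R^-1 `^ p by rewrite mulr_gt0// powR_gt0.
have [d d0 dP] := @heine_itv xi (- N.+1%:R) N.+1%:R _ Axi.1 eN0.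
have dp0 : 0 < d `^ p by exact: powR_gt0.
exists (C0 * (N.+1%:R `^ p / d `^ p + 1)).
  by rewrite mulr_ge0// addr_ge0// divr_ge0// powR_ge0.
move=> s t /andP[Nt tN]; have [std|/ltW dst] := leP `|s - t| d.
  apply: (le_trans (dP s t _ std)); first by rewrite in_itv/= -ler_norml.
  rewrite -[leLHS]addr0 lerD//; first by rewrite ler_pM2l// mono// ltW.
  by rewrite !mulr_ge0 ?powR_ge0// addr_ge0// divr_ge0// powR_ge0.
apply: (le_trans (C0P s t)); rewrite -[leLHS]add0r lerD//.
  by rewrite mulr_ge0 ?powR_ge0// ltW.
rewrite -mulrA ler_wpM2l// mulrDl mul1r lerD2r.
apply: (@le_trans _ _ (N.+1%:R `^ p)); first exact: mono.
rewrite mulrAC -mulrA ler_peMr ?powR_ge0// ler_pdivlMr// mul1r.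
by apply: mono => //; exact: ltW.
Qed.

End growth.

Lemma mx_cvg {R : realType} m n (M_ : 'M[R]_(m, n) ^nat) (M : 'M[R]_(m, n)) :
  (forall i j, M_ k i j @[k --> \oo] --> M i j) -> M_ k @[k --> \oo] --> M.
Proof.
move=> h; apply/cvg_mx_entourageP => A entA.
have H i : \forall k \near \oo, forall j, (M i j, M_ k i j) \in A.
  apply: (@filter_forall nat 'I_n (fun j k => (M i j, M_ k i j) \in A) \oo _) => j.
  have /cvg_entourageP/(_ A entA) Hij := h i j.
  by near=> k; apply/mem_set; near: k; exact: Hij.
have : \forall k \near \oo, forall i j, (M i j, M_ k i j) \in A.
  exact: (@filter_forall nat 'I_m (fun i k => forall j, (M i j, M_ k i j) \in A)).
exact.
Unshelve. all: by end_near. Qed.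

Section Rintegral_sum.
Context d (T : measurableType d) (R : realType) (mu : {measure set T -> \bar R}).

Lemma integrable_sum_EFin I (s : seq I) (F : I -> T -> R) :
  (forall i, mu.-integrable [set: T] (EFin \o F i)) ->
  mu.-integrable [set: T] (EFin \o (fun x => \sum_(i <- s) F i x)).
Proof.
move=> intF; have := @integrable_sum _ _ _ mu _ measurableT _ s xpredT _ (fun i _ => intF i).
by apply: eq_integrable => // x _ /=; rewrite sumEFin.
Qed.

Lemma Rintegral_sum I (s : seq I) (F : I -> T -> R) :
  (forall i, mu.-integrable [set: T] (EFin \o F i)) ->
  \int[mu]_x (\sum_(i <- s) F i x) = \sum_(i <- s) \int[mu]_x F i x.
Proof.
move=> intF; elim: s => [|i s IHs].
  rewrite big_nil; under eq_Rintegral do rewrite big_nil.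
  by rewrite /Rintegral integral0.
under eq_Rintegral do rewrite big_cons.
rewrite big_cons -IHs RintegralD//; exact: integrable_sum_EFin.
Qed.

End Rintegral_sum.

Lemma ecvg0P (R : realType) (u : (\bar R)^nat) : (forall k, 0 <= u k)%E ->
  (forall e : R, 0 < e -> \forall k \near \oo, (u k <= e%:E)%E) ->
  (u k @[k --> \oo] --> 0)%E.
Proof.
move=> u0 ue; apply/fine_cvgP; split.
  near=> k; rewrite ge0_fin_numE// (@le_lt_trans _ _ 1%E) ?ltry//.
  by near: k; exact: ue.
apply/cvgr0Pnorm_le => e e0; near=> k.
rewrite ger0_norm; last exact: fine_ge0.
have uke : (u k <= e%:E)%E by near: k; exact: ue.
rewrite -lee_fin fineK// ge0_fin_numE// (le_lt_trans uke)// ltry.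
Unshelve. all: by end_near. Qed.

Section moment_operator.
Context {R : realType} (p : R) (n : nat) (xi : R -> R).
Hypotheses (p0 : 0 < p) (Axi : Atilde p xi).
Local Notation LT := (caratheodory_type (@borel_lebesgue_cV R n)^*%mu).
Local Notation leb := (@lebesgue_cV R n).
Implicit Types h f : 'cV[R]_n -> R.

Lemma lebesgue_measurable_comp h : lebesgue_measurable h -> lebesgue_measurable (xi \o h).
Proof.
move=> mh; apply: measurableT_comp mh; exact: continuous_measurable_fun Axi.1.
Qed.

Lemma measurable_moment g i j : lebesgue_measurable g ->
  measurable_fun [set: LT] (fun x : LT => g x * (x : 'cV[R]_n) i 0 * (x : 'cV[R]_n) j 0).
Proof.
move=> mg; apply: measurable_funM; last exact: measurable_coord_lebesgue.
by apply: measurable_funM; [exact: mg|exact: measurable_coord_lebesgue].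
Qed.

Lemma moment_integrable h i j : Lp p h -> leb.-integrable [set: LT]
  (EFin \o (fun x : LT => xi (h x) * (x : 'cV[R]_n) i 0 * (x : 'cV[R]_n) j 0)).
Proof.
move=> Lh; have [d xid] := Axi.2.
have int := integrableZl measurableT d (Lp_integrable Lh).
apply: (le_integrable measurableT _ _ int).
  by apply/measurable_EFinP; exact: (measurable_moment i j (lebesgue_measurable_comp Lh.1)).
move=> x _ /=; rewrite lee_fin -mulrA normrM.
apply: le_trans (ler_norm _); rewrite [leRHS]mulrA ler_pM//.
exact: coord_mul_le_enorm.
Qed.

Lemma moment_matrix_valuation h f : Lp p h -> Lp p f ->
  moment_matrix (xi \o (fun x => Num.max (h x) (f x))) +
  moment_matrix (xi \o (fun x => Num.min (h x) (f x))) =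
  moment_matrix (xi \o h) + moment_matrix (xi \o f).
Proof.
move=> Lh Lf; apply/matrixP => i j; rewrite !mxE.
rewrite -RintegralD//; [|exact: moment_integrable (Lp_max _ _ _)|exact: moment_integrable (Lp_min
    _ _ _)].
rewrite -RintegralD//; [|exact: moment_integrable|exact: moment_integrable].
apply: eq_Rintegral => x _ /=; case: leP => _ //.
by rewrite addrC.
Qed.

Lemma moment_matrix_SL h (A : 'M[R]_n) : Lp p h -> \det A = 1 ->
  moment_matrix (xi \o (fun x => h (invmx A *m x))) = A *m moment_matrix (xi \o h) *m A^T.
Proof.
move=> Lh detA; apply/matrixP => i j; rewrite !mxE.
transitivity (\int[leb]_x (xi (h x) * (A *m x) i 0 * (A *m x) j 0)).
  rewrite -(@Rintegral_SL R n A (fun x => xi (h (invmx A *m x)) * (x : 'cV[R]_n) i 0 * (x :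
      'cV[R]_n) j 0)) //.
    by apply: eq_Rintegral => x _; rewrite mulKmx ?unitmx_det1.
  exact: (@moment_integrable (fun x => h (invmx A *m x)) _ _ (Lp_SL p0 (det_invmx1 detA) Lh)).
pose G k l (x : LT) := xi (h x) * (x : 'cV[R]_n) k 0 * (x : 'cV[R]_n) l 0.
have Gint k l : leb.-integrable [set: LT] (EFin \o G k l) by exact: moment_integrable.
have AGint k l : leb.-integrable [set: LT] (EFin \o (fun x => A i k * A j l * G k l x)).
  by have := integrableZl measurableT (A i k * A j l) (Gint k l).
transitivity (\int[leb]_x \sum_l \sum_k (A i k * A j l * G k l x)).
  apply: eq_Rintegral => x _; rewrite !mxE mulr_sumr; apply: eq_bigr => l _.
  rewrite mulr_sumr mulr_suml; apply: eq_bigr => k _; rewrite /G; ring.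
rewrite Rintegral_sum; last first.
  by move=> l; apply: integrable_sum_EFin => k; exact: AGint.
apply: eq_bigr => l _; rewrite Rintegral_sum; last by move=> k; exact: AGint.
rewrite !mxE mulr_suml; apply: eq_bigr => k _; rewrite RintegralZl// !mxE.
by rewrite mulrAC.
Qed.

(* The error is split according to whether |h| lies in [1/N, N], where xi is
   uniformly continuous, or not, where the growth bound and dominated
   convergence in N apply. *)
Lemma moment_dist_cvg0 (h_ : ('cV[R]_n -> R)^nat) h :
  (forall k, Lp p (h_ k)) -> Lp p h ->
  (Lp_integral p (fun x => h_ k x - h x)%R @[k --> \oo] --> 0)%E ->
  (\int[leb]_x (`|xi (h_ k x) - xi (h x)| * enorm (x : 'cV[R]_n) ^+ 2)%:E @[k --> \oo] --> 0)%E.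
Proof.
move=> Lh_ Lh hk0; have [C0 C00 C0P] := Atilde_dist_le p0 Axi.
(* [psi N] keeps only the values outside the annulus on which [Atilde_unif] applies; since it sends
   0 to 0, [psi N (h x)] tends to 0 everywhere. *)
pose psi N (t : R) : R := if (N.+1%:R^-1 <= `|t|) && (`|t| <= N.+1%:R) then 0 else t.
have mpsi N : measurable_fun [set: measurableTypeR R] (psi N).
  apply: measurable_fun_ifT => //.
  by apply: measurable_and; apply: measurable_fun_ler => //; exact: measurableT_comp.
pose g N x := psi N (h x).
have mg N : lebesgue_measurable (g N) by exact: (measurableT_comp (mpsi N) Lh.1).
have gle N x : `|g N x| <= `|h x| by rewrite /g /psi; case: ifP => // _; rewrite normr0.
have Lg N : Lp p (g N) by exact: Lp_dom1 (gle N).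
have g0 : (Lp_integral p (g N) @[N --> \oo] --> 0)%E.
  apply: (Lp_cvg0_dominated p0 mg Lh gle) => x.
  have [hx0|hx0] := eqVneq (h x) 0.
    rewrite (_ : (fun _ => _) = fun=> 0); first exact: cvg_cst.
    by apply/funext => N; rewrite /g /psi hx0; case: ifP.
  have hx1 : 0 < `|h x| by rewrite normr_gt0.
  apply: cvg_near_cst; near=> N; rewrite /g /psi ifT//; apply/andP; split.
    by apply/ltW; near: N; exact: (near_infty_natSinv_lt (PosNum hx1)).
  apply: (@le_trans _ _ N%:R); last by rewrite ler_nat.
  by near: N; exact: nbhs_infty_ger.
apply: ecvg0P => [k|e e0].
  by apply: integral_ge0 => x _; rewrite lee_fin mulr_ge0 ?sqr_ge0.
pose I := fine (Lp_integral p h).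
have Ifin : Lp_integral p h = I%:E.
  by rewrite fineK// ge0_fin_numE ?Lp_integral_ge0//; exact: Lh.2.
have I0 : 0 <= I by exact/fine_ge0/Lp_integral_ge0.
have small (C : R) (u : (\bar R)^nat) : 0 <= C -> (u k @[k --> \oo] --> 0)%E ->
    \forall k \near \oo, (C%:E * u k <= (e / 3)%:E)%E.
  move=> C00' u0; have eC : 0 < e / 3 / (C + 1) by rewrite !divr_gt0// ltr_wpDl.
  have /fine_cvgP[ufin /cvgr0Pnorm_le/(_ _ eC) ule] := u0.
  near=> k.
  have uk : u k \is a fin_num by near: k.
  rewrite -(fineK uk) -EFinM lee_fin.
  have : `|fine (u k)| <= e / 3 / (C + 1) by near: k.
  move=> /(le_trans (ler_norm _)) => H.
  apply: (le_trans (ler_wpM2l C00' H)).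
  by rewrite mulrCA ler_piMr ?divr_ge0 ?(ltW e0)// ler_pdivrMr ?ltr_wpDl// mul1r lerDl.
have [N gN] : exists N, (C0%:E * Lp_integral p (g N) <= (e / 3)%:E)%E.
  near \oo => N; exists N.
  by near: N; exact: small.
(* Three errors of at most e/3. The order matters: N is fixed first, the constant [C'] depends on N,
   and k is taken large last. The summand 1 avoids a division by zero when I = 0. *)
have e1 : 0 < e / 3 / (I + 1) by rewrite !divr_gt0// ltr_wpDl.
have [C' C1' CP'] := Atilde_unif N p0 Axi e1.
pose C := C' + C0; have C1 : 0 <= C by exact: addr_ge0.
have hC := small C _ C1 hk0.
near=> k.
pose w (x : LT) := enorm (x : 'cV[R]_n) ^+ 2.
have mLp f : lebesgue_measurable f -> measurable_fun [set: LT] (fun x : LT => (`|f x| `^ p * w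
    x)%:E).
  by move=> mf; exact/measurable_EFinP/measurable_Lp_integrand.
have mhk : lebesgue_measurable (fun x => h_ k x - h x).
  by apply: measurable_funB; [exact: (Lh_ k).1|exact: Lh.1].
have mxi f : lebesgue_measurable f -> measurable_fun [set: LT] (xi \o f).
  exact: lebesgue_measurable_comp.
have w0 x : 0 <= w x by exact: sqr_ge0.
have pw0 f (x : LT) : (0 <= (`|f x| `^ p * w x)%:E)%E by rewrite lee_fin mulr_ge0// powR_ge0.
apply: (@le_trans _ _ (\int[leb]_x (((e / 3 / (I + 1))%:E * (`|h x| `^ p * w x)%:E
   + C0%:E * (`|g N x| `^ p * w x)%:E) + C%:E * (`|h_ k x - h x| `^ p * w x)%:E))%E).
  apply: ge0_le_integral; first exact: measurableT.
  - by move=> x _; rewrite lee_fin mulr_ge0 ?sqr_ge0.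
  - apply/measurable_EFinP/measurable_funM; last exact: measurable_enorm2.
    apply: (measurableT_comp (@normr_measurable R setT)).
    by apply: measurable_funB; apply: mxi; [exact: (Lh_ k).1|exact: Lh.1].
  - apply: emeasurable_funD; last by apply: measurable_funeM; exact: mLp.
    by apply: emeasurable_funD; apply: measurable_funeM; apply: mLp => //; exact: Lh.1.
  move=> x _; rewrite -!EFinM -!EFinD lee_fin -/(w x).
  move: (w x) (w0 x) => wx wx0; rewrite !mulrA -!mulrDl ler_wpM2r//.
  rewrite {1}/g /psi; case: ifPn => hxN.
    rewrite normr0 powR0 ?gt_eqF// mulr0 addr0 (le_trans (CP' _ _ hxN))// lerD2l.
    by rewrite ler_wpM2r ?powR_ge0// lerDl.
  apply: le_trans (C0P _ _) _; rewrite mulrDr lerD//.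
    by rewrite lerDr mulr_ge0 ?powR_ge0// ltW.
  by rewrite ler_wpM2r ?powR_ge0// lerDr.
have Zl (C2 : R) f : 0 <= C2 -> lebesgue_measurable f ->
    (\int[leb]_x (C2%:E * (`|f x| `^ p * w x)%:E) = C2%:E * Lp_integral p f)%E.
  move=> C20 mf; apply: ge0_integralZl; first exact: measurableT.
  - exact: mLp.
  - by move=> x _.
  - by rewrite lee_fin.
rewrite ge0_integralD; last 5 first.
- exact: measurableT.
- by move=> x _; apply: adde_ge0; apply: mule_ge0; rewrite ?pw0 ?lee_fin ?(ltW e1) ?C00.
- by apply: emeasurable_funD; apply: measurable_funeM; apply: mLp => //; exact: Lh.1.
- by move=> x _; apply: mule_ge0; [rewrite lee_fin|exact: (pw0 (fun x => h_ k x - h x))].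
- by apply: measurable_funeM; exact: (mLp (fun x => h_ k x - h x)).
rewrite ge0_integralD; last 5 first.
- exact: measurableT.
- by move=> x _; apply: mule_ge0; rewrite ?pw0 ?lee_fin ?(ltW e1).
- by apply: measurable_funeM; apply: mLp => //; exact: Lh.1.
- by move=> x _; apply: mule_ge0; rewrite ?pw0 ?lee_fin ?C00 ?C1.
- by apply: measurable_funeM; exact: mLp.
rewrite (Zl _ _ (ltW e1) Lh.1) (Zl _ _ C00 (mg N)) (Zl _ _ C1 mhk).
rewrite [leRHS](_ : _ = (e / 3)%:E + (e / 3)%:E + (e / 3)%:E)%E; last first.
  by rewrite -!EFinD; congr EFin; field.
apply: leeD; first apply: leeD.
  rewrite Ifin -EFinM lee_fin mulrAC ler_pdivrMr ?ltr_wpDl//.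
  by rewrite ler_wpM2l ?lerDl// divr_ge0// ltW.
  exact: gN.
by near: k.
Unshelve. all: by end_near. Qed.

End moment_operator.

Lemma mx_cvg_coord {R : realType} m n (M_ : 'M[R]_(m, n) ^nat) (M : 'M[R]_(m, n)) i j :
  M_ k @[k --> \oo] --> M -> M_ k i j @[k --> \oo] --> M i j.
Proof.
move=> MM.
exact: (@cvg_comp nat 'M[R]_(m, n) R M_ (fun A => A i j) \oo _ _ MM
  (@coord_continuous R m n i j M)).
Qed.

(** * Continuity of the moment operator, and sets of finite weighted measure *)

Section operators.
Context {R : realType} (p : R) (n : nat).
Hypothesis p0 : 0 < p.
Local Notation LT := (caratheodory_type (@borel_lebesgue_cV R n)^*%mu).
Local Notation leb := (@lebesgue_cV R n).
Implicit Types (h f : 'cV[R]_n -> R) (Psi : ('cV[R]_n -> R) -> 'M[R]_n).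

(** As |x_i x_j| <= |x|^2, one weighted L^1 distance controls every entry. *)
Lemma moment_matrix_continuous xi : Atilde p xi ->
  Lp_continuous p (fun h : 'cV[R]_n -> R => moment_matrix (xi \o h)).
Proof.
move=> Axi h_ h Lh_ Lh /(Lp_norm_cvg0 _ p0) hk0; apply: mx_cvg => i j.
have /fine_cvgP[Dfin D0] := moment_dist_cvg0 p0 Axi Lh_ Lh hk0.
apply/cvgrPdist_le => e e0.
move/cvgr0Pnorm_le : D0 => /(_ _ e0) D0.
near=> k; rewrite !mxE -RintegralB;
  [|exact: measurableT|exact: (moment_integrable Axi i j Lh)|
    exact: (moment_integrable Axi i j (Lh_ k))].
pose g (x : LT) := `|xi (h_ k x) - xi (h x)| * enorm (x : 'cV[R]_n) ^+ 2.
have intB : leb.-integrable [set: LT] (EFin \o (fun x : LT =>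
    xi (h x) * (x : 'cV[R]_n) i 0 * (x : 'cV[R]_n) j 0 -
    xi (h_ k x) * (x : 'cV[R]_n) i 0 * (x : 'cV[R]_n) j 0)).
  have := integrableB measurableT (moment_integrable Axi i j Lh) (moment_integrable Axi i j (Lh_
      k)).
  by apply: eq_integrable.
have g0 x : 0 <= g x by rewrite mulr_ge0 ?sqr_ge0.
have gfin : (\int[leb]_x (g x)%:E)%E \is a fin_num by rewrite /g; near: k.
have intg : leb.-integrable [set: LT] (EFin \o g).
  apply/integrableP; split.
    apply/measurable_EFinP/measurable_funM; last exact: measurable_enorm2.
    apply: (measurableT_comp (@normr_measurable R setT)).
    by apply: measurable_funB; apply: (lebesgue_measurable_comp Axi); [exact: (Lh_ k).1|exact:
        Lh.1].
  under eq_integral => x _ do rewrite /= ger0_norm//.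
  by rewrite -ge0_fin_numE// integral_ge0// => x _; rewrite lee_fin.
apply: (le_trans (le_normr_Rintegral measurableT intB)).
apply: (@le_trans _ _ (\int[leb]_x g x)).
  apply: le_Rintegral; [exact: measurableT|exact: integrable_norm|exact: intg|].
  move=> x _; rewrite -!mulrA -mulrBl normrM distrC ler_wpM2l//.
  exact: coord_mul_le_enorm.
rewrite /Rintegral (le_trans (ler_norm _))// /g.
by near: k.
Unshelve. all: by end_near. Qed.

Lemma Lp_eq_integral0 h f : Lp p h -> Lp p f -> Lp_eq h f ->
  Lp_integral p (fun x => h x - f x) = 0%E.
Proof.
move=> Lh Lf hf; have mhf : lebesgue_measurable (fun x => h x - f x).
  by apply: measurable_funB; [exact: Lh.1|exact: Lf.1].
transitivity (\int[leb]_x (cst 0 x))%E; last by rewrite integral0.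
apply: ae_eq_integral.
- exact: measurableT.
- exact/measurable_EFinP/measurable_Lp_integrand.
- exact: measurable_cst.
case: hf => N [mN N0 hfN]; exists N; split=> // x; apply: contra_notP => hfx.
move=> _ /=; have -> : h x = f x by apply: contrapT => hne; apply/hfx/hfN.
by rewrite subrr normr0 powR0 ?gt_eqF// mul0r.
Qed.

(** The constant sequence [h] converges in norm to every [f] that agrees with it almost everywhere;
    limits of matrices are unique. For charges this gives insensitivity to null sets. *)
Lemma Lp_continuous_operator Psi : Lp_continuous p Psi -> Lp_operator p Psi.
Proof.
move=> cPsi h f Lh Lf hf.
have : (fun=> Psi h) @ \oo --> Psi f.
  apply: (cPsi (fun=> h)) => //; apply/(Lp_norm_cvg0 _ p0).
  rewrite Lp_eq_integral0//; exact: cvg_cst.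
move=> PP; apply/matrixP => i j.
have Pij := mx_cvg_coord (i := i) (j := j) PP.
exact/esym/(cvg_unique (@Rhausdorff R) Pij (@cvg_cst _ _ _ \oo _)).
Qed.

(* The exponent is immaterial for indicators: mfin E means that E is Lebesgue
   measurable with finite |x|^2 dx measure. *)
Definition mfin (E : set 'cV[R]_n) := Lp 1 (\1_E : 'cV[R]_n -> R).

Lemma mfin_measurable E : mfin E -> measurable (E : set LT).
Proof. by move=> [mE _]; exact: ((@measurable_indicP _ LT R E).2 mE). Qed.

Lemma lebesgue_measurable_indic (E : set 'cV[R]_n) : measurable (E : set LT) ->
  lebesgue_measurable (\1_E : 'cV[R]_n -> R).
Proof. by move=> mE; exact: measurable_indic. Qed.

Lemma le_mfin (E F : set 'cV[R]_n) : measurable (E : set LT) -> E `<=` F -> mfin F -> mfin E.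
Proof.
move=> mE EF fF; apply: (@Lp_dom1 R 1 n _ (\1_F : 'cV[R]_n -> R)) => //.
  exact: lebesgue_measurable_indic.
move=> x; rewrite !indicE; have [xE|] := boolP (x \in E); last by rewrite normr0.
by rewrite (mem_set (EF _ (set_mem xE))).
Qed.

Lemma mfinI E F : mfin E -> measurable (F : set LT) -> mfin (E `&` F).
Proof.
move=> fE mF; apply: (le_mfin _ _ fE); last exact: subIsetl.
exact: measurableI (mfin_measurable fE) mF.
Qed.

Lemma mfin0 : mfin set0.
Proof. by rewrite /mfin indic0; exact: (@Lp_0 R 1 n). Qed.

Lemma mfin_SL E (A : 'M[R]_n) : \det A = 1 -> mfin E -> mfin [set x | E (A *m x)].
Proof.
move=> detA fE; have := Lp_SL ltr01 detA fE; congr (Lp 1 _).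
Qed.

(** The level enters only through |a|^p, so a single weighted integral of [E] serves all levels and
    exponents. *)
Lemma Lp_integral_indic (a : R) E : mfin E ->
  Lp_integral p (fun x => a * \1_E x) = ((`|a| `^ p)%:E * Lp_integral 1 (\1_E : 'cV[R]_n -> R))%E.
Proof.
move=> fE; rewrite /Lp_integral -ge0_integralZl; last 4 first.
- exact: measurableT.
- exact: (measurable_int _ (Lp_integrable fE)).
- by move=> x _; rewrite lee_fin mulr_ge0 ?powR_ge0 ?sqr_ge0.
- by rewrite lee_fin powR_ge0.
apply: eq_integral => x _; rewrite -EFinM; congr EFin.
rewrite normrM powRM// -[LHS]mulrA; congr (_ * (_ * _)).
rewrite powRr1// indicE; case: (x \in E); rewrite ?normr1 ?powR1//.
by rewrite normr0 powR0 ?gt_eqF.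
Qed.

Lemma Lp_indic (a : R) E : mfin E -> Lp p (fun x => a * \1_E x).
Proof.
move=> fE; split.
  apply: measurable_funM; first exact: measurable_cst.
  exact: (lebesgue_measurable_indic (mfin_measurable fE)).
rewrite Lp_integral_indic// lte_mul_pinfty ?lee_fin ?powR_ge0//.
exact: fE.2.
Qed.

End operators.

(** * Elementary matrices of determinant one *)

Lemma third_ord n (i j : 'I_n) : (2 < n)%N -> exists k : 'I_n, k != i /\ k != j.
Proof.
move=> n2; have [/existsP[k /andP[ki kj]]|/existsPn H] :=
  boolP [exists k : 'I_n, (k != i) && (k != j)]; first by exists k.
have : (size (enum 'I_n) <= size [:: i; j])%N.
  apply: uniq_leq_size (enum_uniq _) _ => k _; move: (H k); rewrite !inE.
  by case: eqP => //= _; case: eqP.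
by rewrite size_enum_ord leqNgt n2.
Qed.

Section elementary_matrices.
Context {R : realType} (n : nat).
Implicit Types (i j k l : 'I_n) (t d : R).

Definition shear k l t : 'M[R]_n := 1%:M + t *: delta_mx k l.

Lemma shearE m k l t (A : 'M[R]_(n, m)) i (j : 'I_m) :
  (shear k l t *m A) i j = A i j + (i == k)%:R * t * A l j.
Proof.
rewrite mulmxDl mul1mx -scalemxAl !mxE; congr (_ + _).
rewrite (bigD1 l)//= big1 => [|a al]; last by rewrite mxE (negPf al) andbF mul0r.
by rewrite mxE eqxx andbT addr0 mulrA [t * _]mulrC.
Qed.

Lemma shear_conjE k l t (A : 'M[R]_n) i j :
  (shear k l t *m A *m (shear k l t)^T) i j =
  A i j + (i == k)%:R * t * A l j + (j == k)%:R * t * (A i l + (i == k)%:R * t * A l l).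
Proof.
rewrite -[_ *m _^T]trmxK trmx_mul trmxK mxE shearE.
by rewrite ![(_ *m A)^T _ _]mxE !shearE.
Qed.

Lemma det_shear k l t : k != l -> \det (shear k l t) = 1.
Proof.
move=> kl.
have diag1 a : shear k l t a a = 1.
  rewrite !mxE eqxx; case: eqP => [->|_]; rewrite ?(negPf kl) ?mulr0 ?addr0//.
have off (a b : 'I_n) : (a < b)%N -> (a == b)%:R = 0 :> R by move=> ab; rewrite -val_eqE/= ltn_eqF.
have [lk|kl'] := ltnP l k.
  rewrite det_trig; first by rewrite big1.
  apply/is_trig_mxP => a b ab; rewrite !mxE off// add0r.
  have [/andP[/eqP ak /eqP bl]|_] := boolP ((a == k) && (b == l)); last by rewrite mulr0.
  by move: ab; rewrite ak bl ltnNge ltnW.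
rewrite -det_tr det_trig; first by rewrite big1// => a _; rewrite mxE.
apply/is_trig_mxP => a b ab; rewrite !mxE eq_sym off// add0r.
have [/andP[/eqP bk /eqP al]|_] := boolP ((b == k) && (a == l)); last by rewrite mulr0.
by move: ab; rewrite bk al ltnNge kl'.
Qed.

Lemma shearK k l t : k != l -> shear k l (- t) *m shear k l t = 1%:M.
Proof.
move=> kl; apply/matrixP => i j; rewrite shearE !mxE [l == k]eq_sym (negPf kl).
by rewrite [l == j]eq_sym; case: (i == k); case: (j == l) => /=; ring.
Qed.

Definition dcoef i k d j : R := if j == i then d else if j == k then d^-1 else 1.

Definition dmx i k d : 'M[R]_n := diag_mx (\row_j dcoef i k d j).

Lemma dmxE m i k d (A : 'M[R]_(n, m)) a (b : 'I_m) : (dmx i k d *m A) a b = dcoef i k d a * A a b.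
Proof. by rewrite mul_diag_mx !mxE. Qed.

Lemma dmx_conjE i k d (A : 'M[R]_n) a b :
  (dmx i k d *m A *m (dmx i k d)^T) a b = dcoef i k d a * dcoef i k d b * A a b.
Proof.
by rewrite /dmx tr_diag_mx mul_mx_diag mul_diag_mx !mxE mulrAC.
Qed.

Lemma det_dmx i k d : i != k -> d != 0 -> \det (dmx i k d) = 1.
Proof.
move=> ik d0; rewrite det_diag (bigD1 i)//= (bigD1 k) 1?eq_sym//= big1.
  by rewrite !mxE /dcoef !eqxx eq_sym (negPf ik) mulr1 divff.
by move=> j /andP[/negPf ji /negPf jk]; rewrite mxE /dcoef ji jk.
Qed.

Lemma dmxK i k d : d != 0 -> dmx i k d^-1 *m dmx i k d = 1%:M.
Proof.
move=> d0; apply/matrixP => a b; rewrite dmxE !mxE; have [->|ab] := eqVneq a b; last first.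
  by rewrite mulr0n mulr0.
rewrite !mulr1n /dcoef; case: ifP => _; first by rewrite mulVf.
by case: ifP => _; rewrite ?mulr1// invrK divff.
Qed.

Lemma invmx_left (A B : 'M[R]_n) : B *m A = 1%:M -> invmx A = B.
Proof. by move=> BA; have [_ uA] := mulmx1_unit BA; rewrite -[LHS]mul1mx -BA -mulmxA mulmxV//
    mulmx1. Qed.

(** With k different from i and j, diag(2_i, 1/2_k) multiplies the (i, j) entry by 2, or by 4 when i
    = j, so the entry must vanish. *)
Lemma SL_invariant_mx (C : 'M[R]_n) : (2 < n)%N ->
  (forall A : 'M[R]_n, \det A = 1 -> C = A *m C *m A^T) -> C = 0.
Proof.
move=> n2 HC; apply/matrixP => i j; rewrite mxE.
have [k [ki kj]] := third_ord i j n2.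
have two0 : 2 != 0 :> R by rewrite pnatr_eq0.
have ik : i != k by rewrite eq_sym.
have := congr1 (fun B : 'M[R]_n => B i j) (HC _ (det_dmx ik two0)).
rewrite dmx_conjE /dcoef eqxx; have [->|ji] := eqVneq j i; first by lra.
rewrite eq_sym (negPf kj). lra.
Qed.

End elementary_matrices.

(** * Covariant matrix valued charges *)

Section covariant_set_functions.
Context {R : realType} (n : nat).
Local Notation LT := (caratheodory_type (@borel_lebesgue_cV R n)^*%mu).
Local Notation leb := (@lebesgue_cV R n).
Implicit Types (E F B N : set 'cV[R]_n) (M : set 'cV[R]_n -> 'M[R]_n).

(** The second clause is dominated convergence for indicators. Unlike continuity along increasing
    unions, it also covers families of cones that depend on a real parameter. *)
Definition covariant_charge M : Prop :=
  [/\ forall E F, mfin E -> mfin F -> E `&` F = set0 -> M (E `|` F) = M E + M F,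
      forall (E_ : nat -> set 'cV[R]_n) E B, mfin B ->
        (forall k : nat, measurable (E_ k : set LT) /\ E_ k `<=` B) ->
        measurable (E : set LT) ->
        (forall x, \forall k \near \oo, E_ k x <-> E x) ->
        forall i j, M (E_ k) i j @[k --> \oo] --> M E i j,
      forall E (A : 'M[R]_n), mfin E -> \det A = 1 ->
        M [set x | E (invmx A *m x)] = A *m M E *m A^T &
      forall E N, mfin E -> measurable (N : set LT) -> leb N = 0%E -> M (E `\` N) = M E].

Lemma covariant_charge_sub c M1 M2 : covariant_charge M1 -> covariant_charge M2 ->
  covariant_charge (fun E => M1 E - c *: M2 E).
Proof.
move=> [A1 C1 S1 N1] [A2 C2 S2 N2]; split.
- by move=> E F fE fF EF; rewrite A1// A2// scalerDr opprD addrACA.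
- move=> E_ E B fB mE_ mE EE i j; rewrite !mxE.
  rewrite [X in X @ _ --> _](_ : _ = fun k => M1 (E_ k) i j - c * M2 (E_ k) i j); last first.
    by apply/funext => k; rewrite !mxE.
  apply: cvgB; first exact: C1 fB mE_ mE EE i j.
  by apply: cvgMl_tmp; exact: C2 fB mE_ mE EE i j.
- move=> E A fE detA; rewrite S1// S2// mulmxBr mulmxBl -scalemxAr -scalemxAl.
  by [].
- by move=> E N fE mN N0; rewrite N1// N2.
Qed.

(** For disjoint E and F, the maximum of a 1_E and a 1_F is a 1_(E u F) and the minimum is 0 when a
    >= 0; for a <= 0 the two exchange roles. Either way [Psi0] removes one term of the valuation
    identity. *)
Lemma covariant_charge_indic (p a : R) Psi : 0 < p -> Psi (fun _ : 'cV[R]_n => 0) = 0 ->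
  Lp_continuous p Psi -> SL_covariant p Psi -> valuation p Psi ->
  covariant_charge (fun E => Psi (fun x => a * \1_E x)).
Proof.
move=> p0 Psi0 cPsi sPsi vPsi; split.
- move=> E F fE fF EF.
  have := vPsi _ _ (Lp_indic p0 a fE) (Lp_indic p0 a fF).
  have EFx x : ~ (E x /\ F x) by move=> h; have : (E `&` F) x by []; rewrite EF.
  have [a0|/ltW a0] := leP 0 a.
    rewrite (_ : (fun x => Num.max _ _) = fun x => a * \1_(E `|` F) x); last first.
      apply/funext => x; rewrite !indicE in_setU.
      have [xE|xE] := boolP (x \in E); have [xF|xF] := boolP (x \in F);
        rewrite /= ?mulr0 ?mulr1 ?maxxx//; [exact: max_l|exact: max_r].
    rewrite (_ : (fun x => Num.min _ _) = fun x => 0) ?Psi0 ?addr0//.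
    apply/funext => x; rewrite !indicE.
    have [xE|xE] := boolP (x \in E); have [xF|xF] := boolP (x \in F);
      rewrite /= ?mulr0 ?mulr1 ?minxx//; [|exact: min_r|exact: min_l].
    by case: (EFx x); split; exact: set_mem.
  rewrite addrC (_ : (fun x => Num.min _ _) = fun x => a * \1_(E `|` F) x); last first.
    apply/funext => x; rewrite !indicE in_setU.
    have [xE|xE] := boolP (x \in E); have [xF|xF] := boolP (x \in F);
      rewrite /= ?mulr0 ?mulr1 ?minxx//; [exact: min_l|exact: min_r].
  rewrite (_ : (fun x => Num.max _ _) = fun x => 0) ?Psi0 ?addr0//.
  apply/funext => x; rewrite !indicE.
  have [xE|xE] := boolP (x \in E); have [xF|xF] := boolP (x \in F);
    rewrite /= ?mulr0 ?mulr1 ?maxxx//; [|exact: max_r|exact: max_l].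
  by case: (EFx x); split; exact: set_mem.
- move=> E_ E B fB mE_ mE EE i j.
  have EB : E `<=` B.
    move=> x Ex; near \oo => k; apply: (mE_ k).2.
    by apply/(near (EE x) k).
  have fE_ k : mfin (E_ k) by have [mk kB] := mE_ k; exact: le_mfin kB fB.
  have fE : mfin E by exact: le_mfin EB fB.
  apply: mx_cvg_coord.
  apply: cPsi; [by move=> k; exact: (Lp_indic p0 a (fE_ k))|exact: (Lp_indic p0 a fE)|].
  apply/(Lp_norm_cvg0 _ p0).
  apply: (@Lp_cvg0_dominated R p n _ (fun x => a * \1_B x) p0).
  + move=> k; apply: measurable_funB; [exact: (Lp_indic p0 a (fE_ k)).1|exact: (Lp_indic p0 a
      fE).1].
  + exact: (Lp_indic p0 a fB).
  + move=> k x; rewrite -mulrBr !normrM ler_wpM2l// !indicE.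
    have [xB|xB] := boolP (x \in B).
      by case: (x \in E_ k); case: (x \in E); rewrite ?subrr ?subr0 ?sub0r ?normrN ?normr1 ?normr0.
    rewrite (memNset (_ : ~ E_ k x)) ?(memNset (_ : ~ E x)) ?subrr//.
      by move=> /EB /mem_set; rewrite (negPf xB).
    by move=> /(mE_ k).2 /mem_set; rewrite (negPf xB).
  + move=> x; apply: cvg_near_cst; near=> k.
    have Ek : E_ k x <-> E x by near: k; exact: EE.
    rewrite !indicE (_ : (x \in E_ k) = (x \in E)) ?subrr//.
    by apply/idP/idP => /set_mem/Ek/mem_set.
- move=> E A fE detA; exact: (sPsi _ _ (Lp_indic p0 a fE) detA).
- move=> E N fE mN N0.
  have fEN : mfin (E `\` N).
    by apply: (le_mfin _ _ fE); [exact: measurableD (mfin_measurable fE) mN|exact: subDsetl].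
  apply: (Lp_continuous_operator p0 cPsi); [exact: (Lp_indic p0 a fEN)|exact: (Lp_indic p0 a fE)|].
  exists N; split=> // x; apply: contra_notP => Nx.
  rewrite /= !indicE in_setD (_ : (x \in N) = false) ?andbT//.
  by apply/negbTE/negP => /set_mem.
Unshelve. all: by end_near. Qed.

End covariant_set_functions.

(* phi vanishes at the rational multiples of c, from which any t >= 0 is
   approached from the left. *)
Lemma cauchy_zero {R : realType} (phi : R -> R) (c : R) :
  (forall s t, 0 <= s -> 0 <= t -> phi (s + t) = phi s + phi t) ->
  (forall (u : R^nat) t, (forall k, 0 <= u k <= t) -> u k @[k --> \oo] --> t ->
    phi (u k) @[k --> \oo] --> phi t) ->
  0 < c -> phi c = 0 -> forall t, 0 <= t -> phi t = 0.
Proof.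
move=> phiD phiC c0 phic t t0.
have phi0 : phi 0 = 0.
  by have := phiD 0 0 (lexx _) (lexx _); rewrite addr0 => /eqP; rewrite -subr_eq subrr eq_sym =>
      /eqP.
have phiM (s : R) k : 0 <= s -> phi (k%:R * s) = k%:R * phi s.
  move=> s0; elim: k => [|k IHk]; first by rewrite !mul0r.
  by rewrite -natr1 !mulrDl !mul1r phiD ?IHk// mulr_ge0.
pose q k : R := c / k.+1%:R.
have q0 k : 0 < q k by rewrite divr_gt0.
have phiq k : phi (q k) = 0.
  have := phiM (q k) k.+1 (ltW (q0 k)).
  rewrite /q mulrCA divff ?mulr1 ?phic ?pnatr_eq0// => /esym/eqP.
  by rewrite mulf_eq0 pnatr_eq0/= => /eqP.
pose u k := (Num.truncn (t / q k))%:R * q k.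
have ut k : u k <= t.
  rewrite /u -ler_pdivlMr//; by rewrite truncn_le divr_ge0// ltW.
have uge k : t - q k <= u k.
  rewrite lerBlDr /u -[X in _ + X]mul1r -mulrDl natr1 -ler_pdivrMr//.
  by apply/ltW/truncnS_gt.
have uc : u k @[k --> \oo] --> t.
  apply: (@squeeze_cvgr _ _ _ _ (fun k => t - q k) (cst t)).
  - by apply: nearW => k; rewrite uge ut.
  - rewrite -[X in _ --> X]subr0; apply: cvgB; first exact: cvg_cst.
    rewrite -(mulr0 c); apply: cvgMl_tmp.
    exact: cvg_harmonic.
  - exact: cvg_cst.
have /(cvg_unique (@Rhausdorff R)) : phi (u k) @[k --> \oo] --> phi t.
  apply: phiC => // k; rewrite ut andbT mulr_ge0// ltW//.
move=> /(_ 0); apply.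
rewrite (_ : (fun _ => _) = cst 0); first exact: cvg_cst.
by apply/funext => k; rewrite /u phiM ?phiq ?mulr0// ltW.
Qed.

(** * Cones and their images under shears and diagonal matrices *)

Section cones.
Context {R : realType} (n : nat).
Local Notation leb := (@lebesgue_cV R n).
Implicit Types (E F B N : set 'cV[R]_n) (l k : 'I_n) (al be : 'I_n -> R).

Lemma mfin_bounded E C : measurable E -> (forall x, E x -> forall i, `|x i 0| <= C) -> mfin E.
Proof.
move=> mE EC; have mE' := measurable_borel_lebesgue mE.
(* The summand 1 gives the strict lower bound that the half-open cube demands. *)
pose D := `|C| + 1.
have D0 : 0 <= D by rewrite addr_ge0.
have mQ := @measurable_cube R n (- D) D.
have EQ : E `<=` @cube R n (- D) D.
  move=> x Ex i; have := EC x Ex i; rewrite ler_norml => /andP[Cx xC].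
  apply/andP; split.
    by rewrite (lt_le_trans _ Cx)// ltrN2 (le_lt_trans (ler_norm C))// ltrDl.
  by rewrite (le_trans xC)// (le_trans (ler_norm C))// lerDl.
apply: (le_mfin mE' EQ); have mQ' := measurable_borel_lebesgue mQ.
split; first exact: lebesgue_measurable_indic.
apply: (@le_lt_trans _ _ (\int[leb]_x ((n%:R * D ^+ 2)%:E * (\1_(@cube R n (- D) D) (x :
    'cV[R]_n))%:E))%E).
  apply: ge0_le_integral.
  - exact: measurableT.
  - by move=> x _; rewrite lee_fin mulr_ge0 ?powR_ge0 ?sqr_ge0.
  - apply/measurable_EFinP/measurable_Lp_integrand; exact: lebesgue_measurable_indic.
  - apply: measurable_funeM; apply/measurable_EFinP; exact: lebesgue_measurable_indic.
  move=> x _; rewrite -EFinM lee_fin powRr1// indicE.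
  have [/set_mem xQ|_] := boolP (_ \in _); last by rewrite normr0 mul0r mulr0.
  rewrite normr1 mul1r mulr1 enorm_sqr.
  apply: (@le_trans _ _ (\sum_(i < n) D ^+ 2)).
    apply: ler_sum => i _; rewrite -[leLHS]real_normK ?num_real// ler_pXn2r ?nnegrE//.
    by have /andP[/ltW Dx xD] := xQ i; rewrite ler_norml Dx.
  by rewrite sumr_const card_ord mulr_natl.
rewrite ge0_integralZl; last 4 first.
- exact: measurableT.
- by apply/measurable_EFinP; exact: lebesgue_measurable_indic.
- by move=> x _; rewrite lee_fin.
- by rewrite lee_fin mulr_ge0// sqr_ge0.
rewrite integral_indic; [|exact: measurableT|exact: mQ'].
have Qfin : leb (@cube R n (- D) D) = ((D - - D) ^+ n)%:E.
  by rewrite (lebesgue_cV_borel mQ) borel_cube// (ge0_cp D0).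
by rewrite setIT [X in (_ * X)%E]Qfin -EFinM ltry.
Qed.

(* The shear x_k += t x_l translates [al k, be k[ by t and fixes the rest of the
   cone. *)
Definition cone l (b : R) al be : set 'cV[R]_n :=
  [set x | 0 < x l 0 < b /\ forall k, k != l -> al k * x l 0 <= x k 0 < be k * x l 0].

Lemma measurable_lt (f g : 'cV[R]_n -> R) : measurable_fun setT f -> measurable_fun setT g ->
  measurable [set x | f x < g x].
Proof.
move=> mf mg; have := measurable_fun_ltr mf mg.
by move=> /(_ measurableT [set true] I); rewrite setTI.
Qed.

Lemma measurable_le (f g : 'cV[R]_n -> R) : measurable_fun setT f -> measurable_fun setT g ->
  measurable [set x | f x <= g x].
Proof.
move=> mf mg; have := measurable_fun_ler mf mg.
by move=> /(_ measurableT [set true] I); rewrite setTI.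
Qed.

Lemma measurable_coord l : measurable_fun [set: 'cV[R]_n] (fun x : 'cV[R]_n => x l 0).
Proof. exact: (measurable_cV_coord l). Qed.

Lemma measurable_cone l b al be : measurable (cone l b al be).
Proof.
have mc := measurable_coord.
have mM c : measurable_fun [set: 'cV[R]_n] (fun x : 'cV[R]_n => c * x l 0).
  by apply: measurable_funM; [exact: measurable_cst|exact: mc].
rewrite (_ : cone l b al be = ([set x : 'cV[R]_n | 0 < x l 0] `&` [set x : 'cV[R]_n | x l 0 < b])
    `&`
  \bigcap_(k in [set k | k != l]) ([set x : 'cV[R]_n | al k * x l 0 <= x k 0] `&`
     [set x : 'cV[R]_n | x k 0 < be k * x l 0])); last first.
  apply/seteqP; split => x.
    by move=> [/andP[? ?] H]; split; [split|move=> k /= kl; have /andP[? ?] := H k kl; split].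
  by move=> [[/= ? ?] H]; split; [apply/andP; split|move=> k kl; have [/= ? ?] := H k kl;
      apply/andP; split].
apply: measurableI.
  by apply: measurableI; apply: measurable_lt => //; exact: measurable_cst.
apply: fin_bigcap_measurable; first exact: finite_finset.
by move=> k _; apply: measurableI; [exact: measurable_le|exact: measurable_lt].
Qed.

Lemma mfin_cone l b al be : mfin (cone l b al be).
Proof.
pose C := `|b| + \sum_k (`|al k| + `|be k|) * `|b|.
apply: (@mfin_bounded _ C); first exact: measurable_cone.
move=> x [/andP[x0 xb] xk] i.
have b0 : 0 < b by exact: lt_trans xb.
have S0 k : 0 <= (`|al k| + `|be k|) * `|b| by rewrite mulr_ge0// addr_ge0.
have [->|il] := eqVneq i l.
  rewrite gtr0_norm// (le_trans (ltW xb))// (le_trans (ler_norm b))// lerDl.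
  by apply: sumr_ge0.
rewrite (@le_trans _ _ ((`|al i| + `|be i|) * `|b|))//; last first.
  by rewrite /C (bigD1 i)//= addrCA lerDl addr_ge0// sumr_ge0.
have /andP[h1 h2] := xk i il.
have xb' : x l 0 <= `|b| by rewrite (le_trans (ltW xb))// ler_norm.
rewrite ler_norml; apply/andP; split.
  apply: le_trans h1; rewrite mulrDl opprD.
  apply: (@le_trans _ _ (- (`|al i| * `|b|))); first by rewrite lerBlDr lerDl mulr_ge0.
  apply: (@le_trans _ _ (- (`|al i| * x l 0))); first by rewrite lerN2 ler_wpM2l.
  by rewrite -mulNr ler_wpM2r ?(ltW x0)// lerNl -normrN ler_norm.
apply: (le_trans (ltW h2)); rewrite mulrDl.
apply: (@le_trans _ _ (`|be i| * `|b|)); last by rewrite lerDr mulr_ge0.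
apply: (@le_trans _ _ (`|be i| * x l 0)); last by rewrite ler_wpM2l.
by rewrite ler_wpM2r ?(ltW x0)// ler_norm.
Qed.

Lemma cone_empty l b al be k : k != l -> be k <= al k -> cone l b al be = set0.
Proof.
move=> kl ba; apply/seteqP; split => // x [/andP[x0 _] /(_ k kl)/andP[h1 h2]].
by have := le_lt_trans h1 h2; rewrite ltr_pM2r// ltNge ba.
Qed.

Lemma cone_empty0 l b al be : b <= 0 -> cone l b al be = set0.
Proof.
move=> b0; apply/seteqP; split => // x [/andP[x0 xb] _].
by have := lt_trans x0 xb; rewrite ltNge b0.
Qed.

Definition upd (f : 'I_n -> R) k v j := if j == k then v else f j.

Lemma cone_shear l b al be k t : k != l ->
  [set x | cone l b al be (shear k l (- t) *m x)] =
  cone l b (upd al k (al k + t)) (upd be k (be k + t)).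
Proof.
move=> kl; have lk : l == k = false by rewrite eq_sym (negPf kl).
have sl (x : 'cV[R]_n) : (shear k l (- t) *m x) l 0 = x l 0.
  by rewrite shearE lk !mul0r addr0.
have sk (x : 'cV[R]_n) : (shear k l (- t) *m x) k 0 = x k 0 - t * x l 0.
  by rewrite shearE eqxx mul1r mulNr.
have sj (x : 'cV[R]_n) j : j != k -> (shear k l (- t) *m x) j 0 = x j 0.
  by move=> /negPf jk; rewrite shearE jk !mul0r addr0.
apply/seteqP; split => x [xl xk]; split; [by move: xl; rewrite sl| |by move: xl; rewrite -(sl x)|];
  move=> j jl; have := xk j jl; rewrite /upd sl; (have [->|jk] := eqVneq j k; [rewrite sk
      !mulrDl|by rewrite sj]).
- by rewrite lerBrDr ltrBlDr.
- by rewrite lerBrDr ltrBlDr.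
Qed.

(** The set is the image of the cone under [dmx l k d]: x_l is multiplied by d and x_k divided by
    it, so the slope x_k / x_l is divided by d^2 and every other slope by d. *)
Lemma cone_dmx l b al be k d : k != l -> 0 < d ->
  [set x | cone l b al be (dmx l k d^-1 *m x)] =
  cone l (d * b) (fun j => if j == k then al k / d ^+ 2 else al j / d)
    (fun j => if j == k then be k / d ^+ 2 else be j / d).
Proof.
move=> kl d0; have dn0 : d != 0 by rewrite gt_eqF.
have dl (x : 'cV[R]_n) : (dmx l k d^-1 *m x) l 0 = d^-1 * x l 0.
  by rewrite dmxE /dcoef eqxx.
have dk (x : 'cV[R]_n) : (dmx l k d^-1 *m x) k 0 = d * x k 0.
  by rewrite dmxE /dcoef (negPf kl) eqxx invrK.
have dj (x : 'cV[R]_n) j : j != l -> j != k -> (dmx l k d^-1 *m x) j 0 = x j 0.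
  by move=> /negPf jl /negPf jk; rewrite dmxE /dcoef jl jk mul1r.
have El (x : 'cV[R]_n) : (0 < d^-1 * x l 0 < b) = (0 < x l 0 < d * b).
  by rewrite pmulr_rgt0 ?invr_gt0// ltr_pdivrMl.
have Ek (a c y z : R) : (a * (d^-1 * y) <= d * z < c * (d^-1 * y)) =
    (a / d ^+ 2 * y <= z < c / d ^+ 2 * y).
  rewrite -(ler_pM2l d0 _ z) -(ltr_pM2l d0 z); congr (_ && _).
    by congr (_ <= _); field.
  by congr (_ < _); field.
apply/seteqP; split => x [xl xk]; split; [by move: xl; rewrite dl El| |by rewrite dl El|];
  move=> j jl; have := xk j jl; rewrite dl; have [->|jk] := eqVneq j k;
  (by rewrite dk Ek) || (by rewrite dj// !mulrA).
Qed.

End cones.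

Section upd_lemmas.
Context {R : realType} (n : nat).
Implicit Types (f : 'I_n -> R) (k : 'I_n).

Lemma upd_upd f k s t : upd (upd f k s) k t = upd f k t.
Proof. by apply/funext => j; rewrite /upd; case: (j == k). Qed.

Lemma upd_same f k s : upd f k s k = s.
Proof. by rewrite /upd eqxx. Qed.

Lemma upd_id f k : upd f k (f k) = f.
Proof. by apply/funext => j; rewrite /upd; have [->|] := eqVneq j k. Qed.

End upd_lemmas.

(** * Charges invariant under shears *)

Section shear_invariant_charge.
Context {R : realType} (n : nat) (l : 'I_n) (nu : set 'cV[R]_n -> R).
Local Notation LT := (caratheodory_type (@borel_lebesgue_cV R n)^*%mu).
Implicit Types (E F B N : set 'cV[R]_n) (k : 'I_n) (al be : 'I_n -> R).

Hypothesis nuU : forall E F, mfin E -> mfin F -> E `&` F = set0 -> nu (E `|` F) = nu E + nu F.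
Hypothesis nuC : forall (E_ : nat -> set 'cV[R]_n) E B, mfin B ->
  (forall k : nat, measurable (E_ k : set LT) /\ E_ k `<=` B) -> measurable (E : set LT) ->
  (forall x, \forall k \near \oo, E_ k x <-> E x) -> nu (E_ k) @[k --> \oo] --> nu E.
Hypothesis nu_shear : forall k t E, k != l -> mfin E ->
  nu [set x | E (shear k l (- t) *m x)] = nu E.

Lemma additive_set0 : nu set0 = 0.
Proof.
have := nuU (@mfin0 R n) (@mfin0 R n) (setI0 _).
by rewrite setU0 => /eqP; rewrite -subr_eq subrr eq_sym => /eqP.
Qed.

Lemma cone_translate b al be k t : k != l ->
  nu (cone l b (upd al k (al k + t)) (upd be k (be k + t))) = nu (cone l b al be).
Proof. by move=> kl; rewrite -cone_shear// nu_shear//; exact: mfin_cone. Qed.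

(** Half-open slope intervals make the two pieces exactly disjoint, with no common face to
    discard. *)
Lemma cone_split b al be k s : k != l -> al k <= s <= be k ->
  nu (cone l b al be) = nu (cone l b al (upd be k s)) + nu (cone l b (upd al k s) be).
Proof.
move=> kl /andP[als sbe]; rewrite -nuU; [|exact: mfin_cone|exact: mfin_cone|].
  congr nu; apply/seteqP; split => x.
    move=> [xl xk]; have /andP[xl0 _] := xl; have [xks|xks] := ltP (x k 0) (s * x l 0);
        [left|right];
      split=> // j jl; rewrite /upd; case: eqP => [->|_]; rewrite ?xk//.
      by rewrite xks andbT; have /andP[] := xk k kl.
    by rewrite xks /=; have /andP[] := xk k kl.
  move=> [] [xl xk]; split=> // j jl; have /andP[xl0 _] := xl; have := xk j jl; rewrite /upd;
    case: eqP => [->|_]// /andP[h1 h2]; apply/andP; split=> //.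
    by rewrite (lt_le_trans h2)// ler_wpM2r// ltW.
  by rewrite (le_trans _ h1)// ler_wpM2r// ltW.
apply/seteqP; split => // x [[_ /(_ k kl)] h [_ /(_ k kl)]].
move: h; rewrite /upd eqxx => /andP[_ h1] /andP[h2 _].
by have := lt_le_trans h1 h2; rewrite ltxx.
Qed.

(** By translation the charge depends on the k-th slope interval only through its length. As a
    function [phi] of the length it is additive by splitting and zero at [be k - al k], so
    [cauchy_zero] applies. *)
Lemma cone_zero_step b al be k s t : k != l -> nu (cone l b al be) = 0 -> al k < be k ->
  nu (cone l b (upd al k s) (upd be k t)) = 0.
Proof.
move=> kl nu0 albe; pose phi v := nu (cone l b (upd al k 0) (upd be k v)).
have phiE u v : u <= v -> nu (cone l b (upd al k u) (upd be k v)) = phi (v - u).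
  move=> uv; rewrite /phi -[RHS](cone_translate b _ _ u kl) !upd_same !upd_upd add0r.
  by rewrite subrK.
have [ts|st] := ltP t s.
  by rewrite (@cone_empty _ _ _ _ _ _ k)// ?additive_set0// !upd_same ltW.
rewrite phiE//; apply: (@cauchy_zero R phi (be k - al k)); rewrite ?subr_ge0 ?subr_gt0//.
- move=> u v u0 v0; rewrite {1}/phi (@cone_split _ _ _ k u)// ?upd_same ?u0 ?lerDl//.
  by rewrite !upd_upd (phiE u (u + v)) ?lerDl// [u + v]addrC addrK.
- move=> u v uv uc; apply: (nuC (mfin_cone l b (upd al k 0) (upd be k v))).
  + move=> j; split; first exact/mfin_measurable/mfin_cone.
    move=> x [xl xk]; have /andP[xl0 _] := xl; split=> // i il; have := xk i il.
    rewrite /upd; case: eqP => // ik /andP[-> /=] /lt_le_trans; apply.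
    by rewrite ler_wpM2r ?(ltW xl0)//; have /andP[] := uv j.
  + exact/mfin_measurable/mfin_cone.
  move=> x; have [[xl xk]|nx] := pselect (cone l b (upd al k 0) (upd be k v) x); last first.
    apply: nearW => j; split=> // -[xl xk]; case: nx; have /andP[xl0 _] := xl; split=> // i il.
    have := xk i il; rewrite /upd; case: eqP => // ik /andP[-> /=] /lt_le_trans; apply.
    by rewrite ler_wpM2r ?(ltW xl0)//; have /andP[] := uv j.
  have /andP[xl0 _] := xl; have := xk k kl; rewrite !upd_same => /andP[_ xkv].
  (* The upper slope bound is strict, so a point of the cone remains inside once u_j is close enough
     to v from below. Left continuity is all that [cauchy_zero] asks for. *)
  have xv : x k 0 / x l 0 < v by rewrite ltr_pdivrMr.
  near=> j; split=> // _; split=> // i il; have := xk i il.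
  rewrite /upd; case: eqP => // -> /andP[-> _] /=.
  rewrite -ltr_pdivrMr//; near: j; exact: cvgr_gt uc _ xv.
- by rewrite -phiE ?ltW// !upd_id.
Unshelve. all: by end_near. Qed.

(** The slope intervals are replaced one index at a time: [mix m] carries the new bounds below m and
    the old ones from m on. *)
Lemma cone_zero b al0 be0 : (forall k, al0 k < be0 k) -> nu (cone l b al0 be0) = 0 ->
  forall al be, nu (cone l b al be) = 0.
Proof.
move=> albe0 nu0 al be.
pose mix m (f f0 : 'I_n -> R) (k : 'I_n) := if (k < m)%N then f k else f0 k.
have H m : (m <= n)%N -> nu (cone l b (mix m al al0) (mix m be be0)) = 0.
  elim: m => [|m IHm] mn; first exact: nu0.
  pose j := Ordinal mn.
  have mixS f f0 : mix m.+1 f f0 = upd (mix m f f0) j (f j).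
    apply/funext => k; rewrite /mix /upd ltnS leq_eqVlt.
    have [->|kj] := eqVneq k j; first by rewrite eqxx.
    by rewrite (_ : (k == m :> nat) = false)//; apply/negbTE; apply: contra kj => /eqP km;
        apply/eqP/val_inj.
  (* The bounds at index [l] do not enter the cone, so there the set does not change. *)
  rewrite !mixS; have [jl|jl] := eqVneq j l.
    rewrite -(IHm (ltnW mn)); congr nu; apply/seteqP; split => x [xl xk]; split=> // k kl;
      by have := xk k kl; rewrite /upd jl (negPf kl).
  apply: cone_zero_step => //; first exact: IHm (ltnW mn).
  by rewrite /mix ltnn.
have := H n (leqnn _); congr (nu _ = _); congr cone; apply/funext => k; rewrite /mix ltn_ord//.
Qed.

End shear_invariant_charge.

Section orthants.
Context {R : realType} (n : nat).

(** A generating family closed under intersection, for Dynkin's theorem. In the coordinates (x_l,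
    x_k / x_l), an orthant cuts a cone down to a smaller cone. *)
Definition orthants : set (set 'cV[R]_n) :=
  [set A | exists be : 'I_n -> R, A = [set y : 'cV[R]_n | forall k, y k 0 < be k]].

Lemma orthants_setI : setI_closed orthants.
Proof.
move=> _ _ [b1 ->] [b2 ->]; exists (fun k => Num.min (b1 k) (b2 k)).
apply/seteqP; split => y /=; first by move=> [h1 h2] k; rewrite lt_min h1 h2.
by move=> h; split => k; have := h k; rewrite lt_min => /andP[].
Qed.

Lemma measurable_orthants : @measurable _ 'cV[R]_n = <<s orthants >>.
Proof.
apply/seteqP; split; last first.
  apply: smallest_sub; first exact: sigma_algebra_measurable.
  move=> _ [be ->].
  rewrite (_ : mkset _ = \bigcap_(k in [set: 'I_n]) [set y : 'cV[R]_n | y k 0 < be k]).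
    apply: fin_bigcap_measurable; first exact: finite_finset.
    move=> k _; apply: measurable_lt; [exact: measurable_coord|exact: measurable_cst].
  by apply/seteqP; split => y /= h k; [move=> _|]; exact: h.
pose T : measurableType _ := g_sigma_algebraType orthants.
have mid : measurable_fun [set: T] (id : T -> 'cV[R]_n).
  apply: measurable_fun_cVP => i.
  apply: (measurability _ (RGenInftyO.measurableE R)) => // _ [_ [b ->] <-].
  (* A half-space in coordinate i is the union of orthants whose other bounds m run to infinity. *)
  rewrite setTI (_ : _ @^-1` _ = \bigcup_m [set y : 'cV[R]_n |
      forall k, y k 0 < (if k == i then b else m%:R)]); last first.
    apply/seteqP; split => y; rewrite /= in_itv/=.
      move=> yb; pose f k := (Num.truncn `|y k 0|).+1; exists (\max_k f k)%N => //= k.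
      case: eqP => [->//|_].
      apply: (le_lt_trans (ler_norm _)); apply: (lt_le_trans (truncnS_gt _)).
      by rewrite ler_nat (leq_bigmax (F := f) k).
    by move=> [m _] /(_ i); rewrite eqxx.
  apply: bigcupT_measurable => m; apply: sub_sigma_algebra.
  by exists (fun k => if k == i then b else m%:R).
by move=> A mA; have := mid measurableT A mA; rewrite setTI.
Qed.

End orthants.

Section shear_invariant_charge_zero.
Context {R : realType} (n : nat) (l k0 : 'I_n) (nu : set 'cV[R]_n -> R).
Local Notation LT := (caratheodory_type (@borel_lebesgue_cV R n)^*%mu).
Local Notation leb := (@lebesgue_cV R n).
Implicit Types (E F B N : set 'cV[R]_n) (k : 'I_n) (al be : 'I_n -> R).

Hypothesis k0l : k0 != l.
Hypothesis nuU : forall E F, mfin E -> mfin F -> E `&` F = set0 -> nu (E `|` F) = nu E + nu F.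
Hypothesis nuC : forall (E_ : nat -> set 'cV[R]_n) E B, mfin B ->
  (forall k : nat, measurable (E_ k : set LT) /\ E_ k `<=` B) -> measurable (E : set LT) ->
  (forall x, \forall k \near \oo, E_ k x <-> E x) -> nu (E_ k) @[k --> \oo] --> nu E.
Hypothesis nuN : forall E N, mfin E -> measurable (N : set LT) -> leb N = 0%E ->
  nu (E `\` N) = nu E.
Hypothesis nu_shear : forall k t E, k != l -> mfin E ->
  nu [set x | E (shear k l (- t) *m x)] = nu E.
(** Only vanishing has to be preserved, because a diagonal entry of a covariant charge is multiplied
    by d^2. *)
Hypothesis nu_dmx : forall d E, d != 0 -> mfin E -> nu E = 0 ->
  nu [set x | E (dmx l k0 d^-1 *m x)] = 0.
Variables (b0 : R) (al0 be0 : 'I_n -> R).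
Hypotheses (b0_gt0 : 0 < b0) (albe0 : forall k, al0 k < be0 k).
Hypothesis nu_cone0 : nu (cone l b0 al0 be0) = 0.

Let nu0 : nu set0 = 0.
Proof. exact: (additive_set0 nuU). Qed.

(** The diagonal matrix with d = b / b0 corrects the height; it also distorts the slopes, but these
    can then be changed at will by [cone_zero]. *)
Lemma charge_cone_zero b al be : nu (cone l b al be) = 0.
Proof.
have [b_le0|b_gt0] := leP b 0; first by rewrite cone_empty0.
pose d := b / b0; have d0 : 0 < d by rewrite divr_gt0.
have H := nu_dmx (lt0r_neq0 d0) (mfin_cone l b0 al0 be0) nu_cone0.
rewrite cone_dmx// in H.
rewrite (_ : b = d * b0); last by rewrite divfK// gt_eqF.
apply: (cone_zero nuU nuC nu_shear _ H) => j.
by case: ifP => _; rewrite ltr_pM2r ?invr_gt0 ?exprn_gt0.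
Qed.

(** These cones exhaust the half-space x_l > 0, and each of them is a dominating set for the
    continuity of [nu]. *)
Let Q (m : nat) : set 'cV[R]_n := cone l m%:R (fun=> - m%:R) (fun=> m%:R).

(* In the coordinates theta x = (x_l, x_k / x_l) cones become boxes; the inverse
   is expressed with exp and ln, which are known to be measurable. *)
Let theta (x : 'cV[R]_n) : 'cV[R]_n :=
  \col_k (if k == l then x l 0 else x k 0 * expR (- ln (x l 0))).

Let theta' (y : 'cV[R]_n) : 'cV[R]_n :=
  \col_k (if k == l then y l 0 else y k 0 * y l 0).

Let expln (a : R) : 0 < a -> expR (- ln a) = a^-1.
Proof. by move=> a0; rewrite expRN lnK. Qed.

Let measurable_theta : measurable_fun setT theta.
Proof.
apply: measurable_fun_cVP => k.
have [kl|kl] := eqVneq k l.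
  rewrite (_ : _ \o _ = fun x : 'cV[R]_n => x l 0); first exact: measurable_coord.
  by apply/funext => x; rewrite /cV_coord /= mxE kl eqxx.
rewrite (_ : _ \o _ = fun x : 'cV[R]_n => x k 0 * expR (- ln (x l 0))).
  apply: measurable_funM; first exact: measurable_coord.
  apply: (measurableT_comp (@measurable_expR R)); apply: measurable_funN.
  exact: (measurableT_comp (@measurable_ln R) (measurable_coord l)).
by apply/funext => x; rewrite /cV_coord /= mxE (negPf kl).
Qed.

Let measurable_theta' : measurable_fun setT theta'.
Proof.
apply: measurable_fun_cVP => k.
have [kl|kl] := eqVneq k l.
  rewrite (_ : _ \o _ = fun x : 'cV[R]_n => x l 0); first exact: measurable_coord.
  by apply/funext => x; rewrite /cV_coord /= mxE kl eqxx.
rewrite (_ : _ \o _ = fun x : 'cV[R]_n => x k 0 * x l 0).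
  by apply: measurable_funM; exact: measurable_coord.
by apply/funext => x; rewrite /cV_coord /= mxE (negPf kl).
Qed.

Let thetaK (x : 'cV[R]_n) : 0 < x l 0 -> theta' (theta x) = x.
Proof.
move=> x0; apply/colP => k; rewrite !mxE eqxx; have [->//|kl] := eqVneq k l.
by rewrite expln// mulfVK// gt_eqF.
Qed.

(** The sets A with this property form a Dynkin system: complements by additivity inside [Q m],
    disjoint unions by finite additivity and dominated continuity. *)
Let charge_theta_zero m (A : set 'cV[R]_n) : measurable A ->
  nu (Q m `&` theta @^-1` A) = 0.
Proof.
have mpre (B : set 'cV[R]_n) : measurable B -> measurable (theta @^-1` B).
  by move=> mB; rewrite -[X in measurable X]setTI; exact: measurable_theta.
have fQ : mfin (Q m) by exact: mfin_cone.
have fI (B : set 'cV[R]_n) : measurable B -> mfin (Q m `&` theta @^-1` B).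
  by move=> mB; apply: mfinI => //; exact: (measurable_borel_lebesgue (mpre _ mB)).
rewrite measurable_orthants; move: A.
apply: (dynkin_induction (P := fun A => nu (Q m `&` theta @^-1` A) = 0)).
- exact: measurable_orthants.
- exact: orthants_setI.
- by rewrite preimage_setT setIT charge_cone_zero.
- move=> _ [be ->].
  rewrite (_ : _ `&` _ = cone l (Num.min m%:R (be l)) (fun=> - m%:R) (fun k => Num.min m%:R (be
      k))).
    exact: charge_cone_zero.
  apply/seteqP; split => x.
    move=> [[/andP[xl0 xlm] xk] /= xbe]; split.
      by rewrite xl0 lt_min xlm /=; have := xbe l; rewrite mxE eqxx.
    move=> k kl; have /andP[-> xkm] := xk k kl.
    have := xbe k; rewrite mxE (negPf kl) expln// ltr_pdivrMr// => xkb.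
    by case: (leP m%:R (be k)).
  move=> [/andP[xl0]]; rewrite lt_min => /andP[xlm xlb] xk.
  split; [split; [by rewrite xl0|]|] => /= k.
    move=> kl; have /andP[-> h] := xk k kl; rewrite (lt_le_trans h)//.
    by rewrite ler_wpM2r ?(ltW xl0)// ge_min lexx.
  rewrite mxE; have [->//|kl] := eqVneq k l.
  rewrite expln// ltr_pdivrMr//; have /andP[_ h] := xk k kl; rewrite (lt_le_trans h)//.
  by rewrite ler_wpM2r ?(ltW xl0)// ge_min lexx orbT.
- move=> S mS S0.
  have QS : (Q m `&` theta @^-1` S) `&` (Q m `&` theta @^-1` (~` S)) = set0.
    by rewrite setIACA -preimage_setI setICr preimage_set0 setI0.
  have := nuU (fI _ mS) (fI _ (measurableC mS)) QS.
  rewrite -setIUr -preimage_setU setUv preimage_setT setIT S0 add0r => <-.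
  exact: charge_cone_zero.
- move=> F mF tF F0.
  pose G j := \big[setU/set0]_(i < j) F i.
  have mG j : measurable (G j) by apply: bigsetU_measurable => i _; exact: mF.
  have GE j y : G j y <-> exists2 i, (i < j)%N & F i y.
    by rewrite /G -bigcup_mkord; split => -[i ij Fi]; exists i.
  have G0 j : nu (Q m `&` theta @^-1` (G j)) = 0.
    elim: j => [|j IHj]; first by rewrite /G big_ord0 preimage_set0 setI0.
    have GF : G j `&` F j = set0.
      rewrite /G -bigcup_mkord setI_bigcupl bigcup0// => i /= ij.
      by move/trivIsetP : tF; apply => //; rewrite ltn_eqF.
    have QGF : (Q m `&` theta @^-1` G j) `&` (Q m `&` theta @^-1` F j) = set0.
      by rewrite setIACA -preimage_setI GF preimage_set0 setI0.
    have := nuU (fI _ (mG j)) (fI _ (mF j)) QGF.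
    by rewrite IHj F0 addr0 -setIUr -preimage_setU /G big_ord_recr.
  have mU : measurable (\bigcup_k F k) by exact: bigcupT_measurable.
  have := nuC (E_ := fun j => Q m `&` theta @^-1` (G j)) (E := Q m `&` theta @^-1` (\bigcup_k F
      k)) fQ.
  move=> /(_ _ (mfin_measurable (fI _ mU))) H.
  have {}H : (fun j => nu (Q m `&` theta @^-1` G j)) @ \oo --> nu (Q m `&` theta @^-1` (\bigcup_k
      F k)).
    apply: H => [k|x]; first by split; [exact: (mfin_measurable (fI _ (mG k)))|exact: subIsetl].
    have [[qx [i _ Fi]]|nx] := pselect ((Q m `&` theta @^-1` (\bigcup_k F k)) x).
      near=> j; split=> _; split; [exact: qx|by exists i|exact: qx|].
      rewrite /preimage/=; apply/GE; exists i => //.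
      by near: j; exact: nbhs_infty_gt.
    apply: nearW => j; split=> // -[qx] /= /GE[i _ Fi].
    by case: nx; split=> //; exists i.
  apply: (cvg_unique (@Rhausdorff R) H).
  by rewrite (_ : (fun _ => _) = cst 0); [exact: cvg_cst|apply/funext => j; exact: G0].
Unshelve. all: by end_near. Qed.

Let charge_borel_zero m E : measurable E -> nu (Q m `&` E) = 0.
Proof.
move=> mE; rewrite -(@charge_theta_zero m (theta' @^-1` E)); last first.
  by rewrite -[X in measurable X]setTI; exact: measurable_theta'.
congr nu; apply/seteqP; split => x [qx Ex]; split => //; have [/andP[x0 _] _] := qx.
  by rewrite /preimage/= thetaK.
by move: Ex; rewrite /preimage/= thetaK.
Qed.

Let lebesgue_cone_fin m : (leb (Q m) < +oo)%E.
Proof.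
(* On [Q m] one has x_l < m and |x_k| <= m x_l <= m^2; the final 1 makes the lower bounds strict. *)
pose D : R := m%:R * m%:R + m%:R + 1.
have D0 : 0 <= D by rewrite !addr_ge0// mulr_ge0.
have mQ := measurable_borel_lebesgue (@measurable_cube R n (- D) D).
apply: (@le_lt_trans _ _ (leb (@cube R n (- D) D))); last first.
  rewrite (lebesgue_cV_borel (measurable_cube _ _)) borel_cube ?ltry//.
  by rewrite (ge0_cp D0).
apply: le_measure; rewrite ?inE//; first exact: (mfin_measurable (mfin_cone _ _ _ _)).
move=> x [/andP[x0 xm] xk] i.
have [->|il] := eqVneq i l.
  rewrite (lt_trans _ x0) ?(le_trans (ltW xm))//.
    by rewrite /D -addrA addrCA lerDl addr_ge0// mulr_ge0.
  by rewrite oppr_lt0 /D ltr_wpDl// addr_ge0// mulr_ge0.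
have /andP[h1 h2] := xk i il.
have mm : m%:R * x l 0 <= m%:R * m%:R by rewrite ler_wpM2l// ltW.
have mD : m%:R * m%:R < D by rewrite /D -addrA ltrDl ltr_wpDl.
apply/andP; split; last by rewrite (le_trans (ltW h2))// (le_trans mm)// ltW.
by rewrite (lt_le_trans _ h1)// mulNr ltrN2 (le_lt_trans mm).
Qed.

Let charge_pos_zero E : mfin E -> (forall x, E x -> 0 < x l 0) -> nu E = 0.
Proof.
move=> fE E0; have fQ m : mfin (Q m) by exact: mfin_cone.
have fQE m : mfin (Q m `&` E) by exact: (mfinI (fQ m) (mfin_measurable fE)).
have QE0 m : nu (Q m `&` E) = 0.
  have leb_fin : (leb (Q m `&` E) < +oo)%E.
    apply: le_lt_trans (lebesgue_cone_fin m); apply: le_measure; rewrite ?inE.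
    - exact: (mfin_measurable (fQE m)).
    - exact: (mfin_measurable (fQ m)).
    - exact: subIsetl.
  (* [Q m] meets E in the Borel set given by [Q m] and F, up to the null set [F] minus that
     intersection; the charge does not see the difference. *)
  have [F [mF QEF F0]] := borel_hull (mfin_measurable (fQE m)) leb_fin.
  have mN : measurable (F `\` (Q m `&` E) : set LT).
    exact: measurableD (measurable_borel_lebesgue mF) (mfin_measurable (fQE m)).
  have fQF : mfin (Q m `&` F) by exact: (mfinI (fQ m) (measurable_borel_lebesgue mF)).
  rewrite -(charge_borel_zero m mF) -(nuN fQF mN F0); congr nu.
  apply/seteqP; split => x; first by move=> QEx; split; [split; [case: QEx|exact: QEF]|case].
  by move=> [[Qx Fx] nx]; apply: contrapT => h; exact: nx.
have := nuC (E_ := fun m => Q m `&` E) fE _ (mfin_measurable fE) => H.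
have {}H : nu (Q m `&` E) @[m --> \oo] --> nu E.
  apply: H => [m|x].
    by split; [exact: (mfin_measurable (fQE m))|exact: subIsetr].
  have [Ex|nEx] := pselect (E x); last by apply: nearW => m; split=> // -[].
  (* A point with x_l > 0 lies in [Q m] as soon as m exceeds both x_l and the sum S, which bounds
     all its slopes. *)
  have x0 := E0 _ Ex; pose S := \sum_k `|x k 0| / x l 0.
  have S0 k : 0 <= `|x k 0| / x l 0 by rewrite divr_ge0// ltW.
  near=> m; split=> [[]//|_]; split=> //.
  have xm : x l 0 < m%:R by near: m; exact: nbhs_infty_gtr.
  have Sm : S < m%:R by near: m; exact: nbhs_infty_gtr.
  split; first by rewrite x0 xm.
  move=> k kl; have : `|x k 0| < m%:R * x l 0.
    rewrite -ltr_pdivrMr//; apply: le_lt_trans Sm.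
    by rewrite /S (bigD1 k)//= lerDl sumr_ge0.
  by rewrite ltr_norml mulNr => /andP[/ltW -> ->].
apply: (cvg_unique (@Rhausdorff R) H).
by rewrite (_ : (fun _ => _) = cst 0); [exact: cvg_cst|apply/funext => j; exact: QE0].
Unshelve. all: by end_near. Qed.

(** The hyperplane x_l = 0 is null. The half-space x_l < 0 is carried to x_l > 0 by changing the
    signs of x_l and x_k0 together, which keeps the determinant equal to 1. *)
Lemma shear_invariant_charge_eq0 E : mfin E -> nu E = 0.
Proof.
move=> fE; have mE := mfin_measurable fE.
have mc := @measurable_coord R n l.
have m0 : measurable_fun [set: 'cV[R]_n] (fun=> 0 : R) by exact: measurable_cst.
have mpos := measurable_borel_lebesgue (measurable_lt m0 mc).
have mneg := measurable_borel_lebesgue (measurable_lt mc m0).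
pose P := [set x : 'cV[R]_n | 0 < x l 0]; pose N := [set x : 'cV[R]_n | x l 0 < 0].
pose H := [set x : 'cV[R]_n | x l 0 = 0].
have mH : measurable H.
  rewrite -[X in measurable X]setTI.
  exact: (@measurable_cV_coord R n l measurableT [set 0]).
have fP : mfin (E `&` P) by exact: (mfinI fE mpos).
have fN : mfin (E `&` N) by exact: (mfinI fE mneg).
have H0 : leb H = 0%E by rewrite (lebesgue_cV_borel mH); exact: borel_hyperplane0.
have m1 : -1 != 0 :> R by rewrite oppr_eq0 oner_eq0.
have lk0 : l != k0 by rewrite eq_sym.
pose S := dmx l k0 (-1 : R).
have SS : S *m S = 1%:M by rewrite -[X in X *m _ = _]/(dmx l k0 (-1)) -{1}invrN1 dmxK.
rewrite -(nuN fE (measurable_borel_lebesgue mH) H0).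
rewrite (_ : E `\` H = (E `&` P) `|` (E `&` N)); last first.
  apply/seteqP; split => x.
    move=> [Ex Hx]; have [xl|xl|xl] := ltgtP 0 (x l 0); [by left|by right|by case: Hx].
  by move=> [] [Ex xl]; split=> // Hx; move: xl; rewrite /P /N /= Hx ltxx.
rewrite nuU//; last first.
  apply/seteqP; split => // x [[_ h1] [_ h2]].
  by have := lt_trans h1 h2; rewrite ltxx.
rewrite (charge_pos_zero fP) ?add0r; last by move=> x [].
pose E' := [set x | (E `&` N) (S *m x)].
have fE' : mfin E' by apply: mfin_SL => //; exact: det_dmx.
have nuE' : nu E' = 0.
  apply: charge_pos_zero => // x [_]; rewrite /N /= /S dmxE /dcoef eqxx mulN1r.
  by rewrite oppr_lt0.
rewrite -(nu_dmx m1 fE' nuE'); congr nu.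
apply/seteqP; split => x; rewrite /E' /mkset invrN1 -/S mulmxA SS mul1mx//.
Qed.

End shear_invariant_charge_zero.

(** * Vanishing of covariant charges *)

Section covariant_charge_vanishing.
Context {R : realType} (n : nat) (M : set 'cV[R]_n -> 'M[R]_n).
Hypotheses (n2 : (2 < n)%N) (cM : covariant_charge M).
Local Notation LT := (caratheodory_type (@borel_lebesgue_cV R n)^*%mu).
Local Notation leb := (@lebesgue_cV R n).
Implicit Types (E F : set 'cV[R]_n) (i j k l : 'I_n).

Lemma covariant_charge_shear k l t E i j : k != l -> mfin E ->
  M [set x | E (shear k l (- t) *m x)] i j =
  M E i j + (i == k)%:R * t * M E l j + (j == k)%:R * t * (M E i l + (i == k)%:R * t * M E l l).
Proof.
move=> kl fE; have [_ _ + _] := cM => /(_ _ _ fE (det_shear t kl)).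
by rewrite (invmx_left (shearK t kl)) => ->; rewrite shear_conjE.
Qed.

Lemma covariant_charge_dmx l k d E i j : l != k -> d != 0 -> mfin E ->
  M [set x | E (dmx l k d^-1 *m x)] i j = dcoef l k d i * dcoef l k d j * M E i j.
Proof.
move=> lk d0 fE; have [_ _ + _] := cM => /(_ _ _ fE (det_dmx lk d0)).
by rewrite (invmx_left (dmxK _ _ d0)) => ->; rewrite dmx_conjE.
Qed.

Lemma covariant_chargeU i j E F : mfin E -> mfin F -> E `&` F = set0 ->
  M (E `|` F) i j = M E i j + M F i j.
Proof. by move=> fE fF EF; have [-> //] := cM; rewrite mxE. Qed.

Lemma covariant_charge_cvg i j (E_ : nat -> set 'cV[R]_n) E B : mfin B ->
  (forall k : nat, measurable (E_ k : set LT) /\ E_ k `<=` B) -> measurable (E : set LT) ->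
  (forall x, \forall k \near \oo, E_ k x <-> E x) -> M (E_ k) i j @[k --> \oo] --> M E i j.
Proof. by move=> fB mE_ mE EE; have [_ H _ _] := cM; exact: (H _ _ _ fB mE_ mE EE i j). Qed.

Lemma covariant_charge_null i j E N : mfin E -> measurable (N : set LT) -> leb N = 0%E ->
  M (E `\` N) i j = M E i j.
Proof. by move=> fE mN N0; have [_ _ _ ->] := cM. Qed.

(** Conjugation by the shear x_j += t x_l alters only row and column j, so the (l, l) entry is shear
    invariant. *)
Lemma covariant_charge_diag0 l b0 al0 be0 : 0 < b0 -> (forall k, al0 k < be0 k) ->
  M (cone l b0 al0 be0) l l = 0 -> forall E, mfin E -> M E l l = 0.
Proof.
move=> b00 albe0 M0 E fE; have [k [kl _]] := third_ord l l n2.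
apply: (@shear_invariant_charge_eq0 R n l k (fun E => M E l l) kl _ _ _ _ _ b0 al0 be0) => //.
- exact: covariant_chargeU.
- exact: covariant_charge_cvg.
- exact: covariant_charge_null.
- move=> j t F jl fF; rewrite covariant_charge_shear// eq_sym (negPf jl).
  by rewrite !mul0r !addr0.
- move=> d F d0 fF F0; rewrite covariant_charge_dmx//; last by rewrite eq_sym.
  by rewrite (F0 : M F l l = 0) mulr0.
Qed.

(* Polarization: the (a, a) entry at the images of E under x_a += x_b and
   x_a -= x_b. *)
Lemma covariant_charge_polar a b : a != b -> (forall E, mfin E -> M E a a = 0) ->
  forall E, mfin E -> M E b b = 0 /\ M E a b + M E b a = 0.
Proof.
move=> ab M0 E fE; have H (t : R) : t * M E b a + t * (M E a b + t * M E b b) = 0.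
  have fS : mfin [set x | E (shear a b (- t) *m x)].
    by apply: mfin_SL => //; exact: det_shear.
  by have := M0 _ fS; rewrite covariant_charge_shear// eqxx !mul1r (M0 _ fE) add0r.
by have := H 1; have := H (- 1) => h1 h2; split; lra.
Qed.

(** The shear x_l += t x_i changes the (i, j) entry only for l = j, and then by t times the (i, i)
    entry, which is zero by assumption. So the criterion for shear invariant charges applies once a
    single cone is shown to have value zero. *)
Lemma covariant_charge_offdiag0 : (forall i E, mfin E -> M E i i = 0) ->
  forall i j E, i != j -> mfin E -> M E i j = 0.
Proof.
move=> M0 i j E ij fE; have [k [ki kj]] := third_ord i j n2.
have ji : j != i by rewrite eq_sym.
have ik : i != k by rewrite eq_sym.
have nu_shear l t F : l != i -> mfin F ->
    M [set x | F (shear l i (- t) *m x)] i j = M F i j.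
  move=> li fF; rewrite covariant_charge_shear// eq_sym (negPf li).
  by rewrite !mul0r !addr0 M0// mulr0 addr0.
(* The slope interval [0, 2s[ consists of [0, s[ and its translate by s, which carry equal
   charge. *)
have half b be l s : l != i -> 0 <= s -> be l = s + s ->
    M (cone i b (fun=> 0) be) i j = 2 * M (cone i b (fun=> 0) (upd be l s)) i j.
  move=> li s0 bes.
  rewrite (@cone_split _ _ _ (fun F => M F i j) (@covariant_chargeU i j) _ _ _ l s)//; last first.
    by rewrite bes s0 lerDl.
  rewrite mulr_natl mulr2n; congr (_ + _).
  have := @cone_translate _ _ _ (fun F => M F i j) nu_shear b (fun=> 0) (upd be l s) l s li.
  by rewrite add0r upd_same upd_upd -bes upd_id.
have two0 : 2 != 0 :> R by rewrite pnatr_eq0.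
apply: (@shear_invariant_charge_eq0 R n i j (fun E => M E i j) ji _ _ _ _ _ 1 (fun=> 0) (fun=>
    1)) => //.
- exact: covariant_chargeU.
- exact: covariant_charge_cvg.
- exact: covariant_charge_null.
- by move=> d F d0 fF F0; rewrite covariant_charge_dmx// (F0 : M F i j = 0) mulr0.
(* diag(2_i, 1/2_j) preserves the (i, j) entry, diag(2_i, 1/2_k) doubles it, yet
   both images of the cone split into two translates of the same cone *)
set C := cone i 1 _ _; have fC : mfin C by exact: mfin_cone.
have h1 := covariant_charge_dmx i j ij two0 fC.
have h2 := covariant_charge_dmx i j ik two0 fC.
rewrite !cone_dmx// in h1 h2.
have zero l (e d : R) : (fun m : 'I_n => if m == l then 0 / e else 0 / d) = (fun=> 0).
  by apply/funext => m; rewrite !mul0r if_same.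
rewrite !zero in h1 h2.
have q0 : 0 <= 1 / 2 ^+ 2 :> R by rewrite divr_ge0// exprn_ge0.
have q2 : 1 / 2 = 1 / 2 ^+ 2 + 1 / 2 ^+ 2 :> R by field.
rewrite (half _ _ k _ ki q0) in h1; last by rewrite (negPf kj).
rewrite (half _ _ j _ ji q0) in h2; last by rewrite eq_sym (negPf kj).
move: h1 h2; set W1 := upd _ _ _; set W2 := upd _ _ _.
(* In both cones the slopes along j and k end at 1/4 and the others at 1/2. Twice the common value
   is thus equal both to the value at [C] and to its double. *)
have -> : W1 = W2.
  apply/funext => m; rewrite /W1 /W2 /upd; case: eqVneq => mk; case: eqVneq => mj //.
rewrite /dcoef !eqxx (negPf ji) eq_sym (negPf kj) => -> /eqP.
rewrite divff// mul1r mulr1; lra.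
Qed.

Lemma covariant_charge_eq0 l b0 al0 be0 : 0 < b0 -> (forall k, al0 k < be0 k) ->
  M (cone l b0 al0 be0) l l = 0 -> forall E, mfin E -> M E = 0.
Proof.
move=> b00 albe0 M0.
have Mll := covariant_charge_diag0 b00 albe0 M0.
have Mii i E : mfin E -> M E i i = 0.
  move=> fE; have [<-|il] := eqVneq l i; first exact: Mll.
  exact: (covariant_charge_polar il Mll fE).1.
move=> E fE; apply/matrixP => i j; rewrite mxE.
have [->|ij] := eqVneq i j; first exact: Mii.
exact: covariant_charge_offdiag0.
Qed.

End covariant_charge_vanishing.

(** * Valuations vanishing on indicators *)

Section valuations_vanishing_on_indicators.
Context {R : realType} (p : R) (n : nat) (Theta : ('cV[R]_n -> R) -> 'M[R]_n).
Hypotheses (p0 : 0 < p) (cT : Lp_continuous p Theta) (vT : valuation p Theta).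
Hypothesis T0 : forall a E, mfin E -> Theta (fun x => a * \1_E x) = 0.
Local Notation LT := (caratheodory_type (@borel_lebesgue_cV R n)^*%mu).
Implicit Types (h : 'cV[R]_n -> R).

Lemma mfin_Lp (E : set 'cV[R]_n) : Lp p (\1_E : 'cV[R]_n -> R) -> mfin E.
Proof.
move=> LE; split; first exact: LE.1.
rewrite (_ : Lp_integral 1 _ = Lp_integral p (\1_E : 'cV[R]_n -> R)); first exact: LE.2.
apply: eq_integral => x _; congr (_ * _)%:E; rewrite indicE.
by case: (x \in E); rewrite ?normr1 ?normr0 ?powR1 ?powR0 ?gt_eqF.
Qed.

(** Chebyshev's inequality: the indicator is at most |h| / c. *)
Lemma mfin_superlevel h (c : R) : 0 < c -> Lp p h -> mfin [set x | c <= h x].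
Proof.
move=> c0 Lh; set E := [set x | _].
have mE : measurable (E : set LT).
  have := measurable_fun_ler (@measurable_cst _ _ LT R setT c) Lh.1.
  by move=> /(_ measurableT [set true] I); rewrite setTI.
apply: mfin_Lp.
apply: (@Lp_dom R p n _ h (fun=> 0) (c^-1 `^ p) (lebesgue_measurable_indic mE) Lh (Lp_0 _ p0)) => x.
rewrite normr0 powR0 ?gt_eqF// addr0 -powRM ?invr_ge0 ?(ltW c0)//.
apply: ge0_ler_powR; rewrite ?nnegrE ?(ltW p0)// ?mulr_ge0 ?invr_ge0 ?(ltW c0)//.
rewrite indicE; have [/set_mem|_] := boolP (x \in E).
  by rewrite /E /= normr1 ler_pdivlMl// mulr1 => /le_trans; apply; exact: ler_norm.
by rewrite normr0 mulr_ge0// invr_ge0 ltW.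
Qed.

Section staircase.
Variables (h : 'cV[R]_n -> R) (c : R).
Hypotheses (h0 : forall x, 0 <= h x) (Lh : Lp p h) (c0 : 0 < c).

(* The level sets are nested, so the minimum of staircase k and the next term is
   a multiple of the indicator of the next level set. *)
Fixpoint staircase (k : nat) : 'cV[R]_n -> R :=
  if k is k'.+1 then
    fun x => Num.max (staircase k' x) (k'.+1%:R * c * \1_[set x | k'.+1%:R * c <= h x] x)
  else fun=> 0.

Let ck k : 0 < k.+1%:R * c. Proof. by rewrite mulr_gt0. Qed.

Lemma staircase_ge0 k x : 0 <= staircase k x.
Proof. by case: k => //= k; rewrite le_max mulr_ge0 ?orbT// ltW. Qed.

Lemma staircase_le k x : staircase k x <= k%:R * c.
Proof.
elim: k => [|k IHk] /=; first by rewrite mul0r.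
rewrite ge_max (le_trans IHk) ?ler_pM2r ?ler_nat//= indicE.
by case: (_ \in _); rewrite ?mulr1// mulr0 ltW.
Qed.

Lemma staircase_le_fun k x : staircase k x <= h x.
Proof.
elim: k => [|k IHk] /=; first exact: h0.
rewrite ge_max IHk /= indicE; have [/set_mem|_] := boolP (_ \in _); last by rewrite mulr0.
by rewrite mulr1.
Qed.

Lemma staircase_ge k j x : (j <= k)%N -> j%:R * c <= h x -> j%:R * c <= staircase k x.
Proof.
elim: k => [|k IHk]; first by rewrite leqn0 => /eqP ->; rewrite mul0r.
rewrite leq_eqVlt => /orP[/eqP -> jh|jk jh] /=; rewrite le_max.
  by apply/orP; right; rewrite indicE mem_set// mulr1.
by rewrite IHk.
Qed.

Lemma Lp_staircase k : Lp p (staircase k).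
Proof.
elim: k => [|k IHk] /=; first exact: (Lp_0 _ p0).
exact: (Lp_max p0 IHk (Lp_indic p0 _ (mfin_superlevel (ck k) Lh))).
Qed.

Lemma staircase_zero k : Theta (staircase k) = 0.
Proof.
elim: k => [|k IHk].
  rewrite -(T0 0 (@mfin0 R n)); congr Theta; apply/funext => x.
  by rewrite mul0r.
have fE := mfin_superlevel (ck k) Lh.
have := vT (Lp_staircase k) (Lp_indic p0 (k.+1%:R * c) fE).
rewrite IHk (T0 _ fE) addr0 (_ : (fun x => Num.min _ _) =
    fun x => k%:R * c * \1_[set x | k.+1%:R * c <= h x] x).
  by rewrite (T0 _ fE) addr0.
apply/funext => x; rewrite !indicE; have [/set_mem/= kh|_] := boolP (_ \in _); last first.
  by rewrite !mulr0 min_r// staircase_ge0.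
have kk : k%:R * c <= k.+1%:R * c by rewrite ler_pM2r// ler_nat.
rewrite !mulr1 min_l; last exact: le_trans (staircase_le _ _) kk.
apply/le_anti; rewrite staircase_le staircase_ge//.
exact: le_trans kk kh.
Qed.

End staircase.

Lemma valuation_eq0_ge0 h : (forall x, 0 <= h x) -> Lp p h -> Theta h = 0.
Proof.
move=> h0 Lh; pose c k : R := k.+1%:R^-1.
have c0 k : 0 < c k by rewrite invr_gt0.
pose f k := staircase h (c k) (k.+1 * k.+1).
have Lf k : Lp p (f k) by exact: Lp_staircase.
have fh k x : `|f k x - h x| <= `|h x|.
  rewrite ler0_norm ?subr_le0 ?staircase_le_fun// opprB ger0_norm//.
  by rewrite lerBlDr lerDl staircase_ge0.
have cvgf : (Lp_integral p (fun x => f k x - h x)%R @[k --> \oo] --> 0)%E.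
  apply: (@Lp_cvg0_dominated R p n _ h p0) => // [k|x].
    by apply: measurable_funB; [exact: (Lf k).1|exact: Lh.1].
  apply/norm_cvg0P; apply: (@squeeze_cvgr _ _ _ _ (cst 0) (fun k => c k)).
  - near=> k; rewrite normr_ge0/= ler0_norm ?subr_le0 ?staircase_le_fun// opprB lerBlDr -lerBlDl.
    pose j := Num.truncn (h x * k.+1%:R).
    have hk : h x <= k.+1%:R.
      apply: (@le_trans _ _ k%:R); last by rewrite ler_nat.
      by near: k; exact: nbhs_infty_ger.
    have hk0 : 0 <= h x * k.+1%:R by rewrite mulr_ge0.
    have jh : j%:R * c k <= h x by rewrite ler_pdivrMr// truncn_le.
    have jk : (j <= k.+1 * k.+1)%N.
      rewrite -(ler_nat R) natrM (@le_trans _ _ (h x * k.+1%:R)) ?truncn_le//.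
      by rewrite ler_wpM2r.
    apply: le_trans (staircase_ge jk jh); rewrite lerBlDr -{2}[c k]mul1r -mulrDl natr1.
    by rewrite ler_pdivlMr// ltW// truncnS_gt.
  - exact: cvg_cst.
  - exact: cvg_harmonic.
have := cT Lf Lh ((Lp_norm_cvg0 _ p0).2 cvgf).
move=> H; apply/matrixP => i j; rewrite mxE.
have := mx_cvg_coord (i := i) (j := j) H.
move=> /(cvg_unique (@Rhausdorff R)); apply.
rewrite (_ : (fun _ => _) = cst 0); first exact: cvg_cst.
by apply/funext => k; rewrite staircase_zero// mxE.
Unshelve. all: by end_near. Qed.

End valuations_vanishing_on_indicators.

Section valuation_eq0.
Context {R : realType} (p : R) (n : nat) (Theta : ('cV[R]_n -> R) -> 'M[R]_n).
Hypotheses (p0 : 0 < p) (cT : Lp_continuous p Theta) (vT : valuation p Theta).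
Hypothesis T0 : forall a E, mfin E -> Theta (fun x => a * \1_E x) = 0.
Implicit Types (h : 'cV[R]_n -> R).

Lemma Lp_opp h : Lp p h -> Lp p (fun x => - h x).
Proof.
move=> Lh; apply: (Lp_dom1 p0 _ Lh) => [|x]; last by rewrite normrN.
by apply: measurable_funN; exact: Lh.1.
Qed.

Lemma valuation_eq0_le0 h : (forall x, h x <= 0) -> Lp p h -> Theta h = 0.
Proof.
move=> h0 Lh.
have := @valuation_eq0_ge0 R p n (fun f => Theta (fun x => - f x)) p0 _ _ _ (fun x => - h x).
under [X in Theta X]eq_fun do rewrite opprK.
apply.
- move=> h_ f Lh_ Lf hf.
  apply: (cT (fun k => Lp_opp (Lh_ k)) (Lp_opp Lf)).
  have intN k : Lp_integral p (fun x => - h_ k x - - f x) = Lp_integral p (fun x => h_ k x - f x).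
    by apply: eq_integral => x _; rewrite -opprD normrN.
  rewrite (_ : (fun k => _) = (fun k => Lp_norm p (fun x => h_ k x - f x))).
    exact: hf.
  by apply/funext => k; rewrite /Lp_norm intN.
- move=> f g Lf Lg; rewrite -(vT (Lp_opp Lf) (Lp_opp Lg)) addrC.
  by congr (Theta _ + Theta _); apply/funext => x; rewrite ?oppr_min ?oppr_max.
- move=> a E fE; rewrite -(T0 (- a) fE); congr Theta; apply/funext => x.
  by rewrite mulNr.
- by move=> x; rewrite oppr_ge0.
- exact: Lp_opp.
Qed.

Lemma valuation_eq0 h : Lp p h -> Theta h = 0.
Proof.
move=> Lh; have L0 := @Lp_0 R p n p0.
have := vT Lh L0; rewrite (@valuation_eq0_ge0 R p n Theta p0 cT vT T0 (fun x => Num.max (h x)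
    0)); last 2 first.
- by move=> x; rewrite le_max lexx orbT.
- exact: Lp_max.
rewrite valuation_eq0_le0; last 2 first.
- by move=> x; rewrite ge_min lexx orbT.
- exact: Lp_min.
rewrite (@valuation_eq0_ge0 R p n Theta p0 cT vT T0 (fun=> 0))//.
by rewrite !addr0 => <-.
Qed.

End valuation_eq0.

(** * Representation *)

Section homothety.
Context {R : realType} (n : nat).
Local Notation LT := (caratheodory_type (@borel_lebesgue_cV R n)^*%mu).
Local Notation leb := (@lebesgue_cV R n).

Section scale.
Variables (r : R) (r0 : 0 < r).
Let phi (x : 'cV[R]_n) : 'cV[R]_n := r *: x.
Let psi (x : 'cV[R]_n) : 'cV[R]_n := r^-1 *: x.
Let c : R := r^-1 ^+ n.
Let c0 : 0 < c. Proof. by rewrite exprn_gt0// invr_gt0. Qed.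
Let sphi : scales phi c. Proof. exact: scales_homothety. Qed.
Let spsi : scales psi c^-1.
Proof. by rewrite /c -exprVn; apply: scales_homothety; rewrite invr_gt0. Qed.
Let phiK : cancel phi psi.
Proof. by move=> x; rewrite /phi /psi scalerA mulVf ?scale1r// gt_eqF. Qed.
Let psiK : cancel psi phi.
Proof. by move=> x; rewrite /phi /psi scalerA mulfV ?scale1r// gt_eqF. Qed.

Lemma measurable_homothety : measurable_fun [set: LT] (phi : LT -> LT).
Proof. exact: measurable_scales_lebesgue c0 sphi spsi phiK psiK. Qed.

Lemma integral_homothety (f : LT -> \bar R) :
  measurable_fun [set: LT] f -> (forall x, 0 <= f x)%E ->
  (\int[leb]_x f (r *: (x : 'cV[R]_n) : LT) = (r^-1 ^+ n)%:E * \int[leb]_x f x)%E.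
Proof.
move=> mf f0.
have := @ge0_integral_pushforward _ _ _ _ R _ measurable_homothety leb setT f.
rewrite preimage_setT => <-; [|exact: measurableT|exact: mf|by move=> x _].
have := @ge0_integral_mscale _ LT R leb setT measurableT (NngNum (ltW c0)) f mf (fun x _ => f0 x).
move=> <-; apply: eq_measure_integral.
  exact: measurable_homothety.
move=> mA X mX _.
exact: (lebesgue_cV_scales c0 sphi spsi psiK X).
Qed.

End scale.

Lemma integral_indic_homothety (r : R) (E : set 'cV[R]_n) (q : 'cV[R]_n -> R) : 0 < r ->
  measurable (E : set LT) -> measurable_fun [set: LT] (q : LT -> R) ->
  (forall x, 0 <= q x) -> (forall x, q (r *: x) = r ^+ 2 * q x) ->
  (\int[leb]_x (\1_[set x : 'cV[R]_n | E (r^-1 *: x)] (x : 'cV[R]_n) * q x)%:E =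
   (r ^+ n.+2)%:E * \int[leb]_x (\1_E (x : 'cV[R]_n) * q x)%:E)%E.
Proof.
move=> r0 mE mq q0 qr.
have mf : measurable_fun [set: LT] (fun x : LT => (\1_E (x : 'cV[R]_n) * q x)%:E).
  by apply/measurable_EFinP/measurable_funM; [exact: lebesgue_measurable_indic|exact: mq].
pose f (x : LT) : \bar R := ((r ^+ 2)%:E * (\1_E (x : 'cV[R]_n) * q x)%:E)%E.
have f0 x : (0 <= (\1_E (x : 'cV[R]_n) * q x)%:E)%E by rewrite lee_fin mulr_ge0.
have mf2 : measurable_fun [set: LT] f by exact: measurable_funeM.
have f20 x : (0 <= f x)%E by rewrite mule_ge0// lee_fin sqr_ge0.
have rV0 : 0 < r^-1 by rewrite invr_gt0.
have := integral_homothety rV0 mf2 f20; rewrite invrK => H.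
transitivity (\int[leb]_x f (r^-1 *: (x : 'cV[R]_n) : LT))%E.
  apply: eq_integral => x _; rewrite /f -EFinM mulrCA -qr scalerA mulfV ?gt_eqF// scale1r.
  congr (_ * _)%:E; rewrite !indicE; congr (_%:R).
rewrite H /f ge0_integralZl; [|exact: measurableT|exact: mf|by move=> x _|by rewrite lee_fin
    sqr_ge0].
by rewrite muleA -EFinM -exprD addn2.
Qed.

End homothety.

Section moments_of_sets.
Context {R : realType} (n : nat).
Local Notation LT := (caratheodory_type (@borel_lebesgue_cV R n)^*%mu).
Local Notation leb := (@lebesgue_cV R n).
Implicit Types (E : set 'cV[R]_n) (i j : 'I_n) (p : R).

(* Since tent 0 = 0 and tent 1 = 1, K(1_E) = K(tent o 1_E), and the latter is
   covered by the results on K(xi o h) with xi in Atilde. *)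
Definition tent (t : R) : R := Num.max 0 (1 - 2 * `|t - 1|).

Lemma tent0 : tent 0 = 0.
Proof. by rewrite /tent sub0r normrN1 mulr1 max_l// subr_le0 ler1n. Qed.

Lemma tent1 : tent 1 = 1.
Proof. by rewrite /tent subrr normr0 mulr0 subr0 max_r. Qed.

Lemma tent_Atilde p : 0 < p -> Atilde p tent.
Proof.
move=> p0; split.
  move=> t.
  have : {for t, continuous ((fun=> 0 : R^o) \max (fun s : R => (1 - 2 * `|s - 1|) : R^o))}.
    apply: continuous_max; first exact: cst_continuous.
    apply: cvgB; first exact: cvg_cst.
    apply: cvgM; first exact: cvg_cst.
    by apply: cvg_norm; apply: cvgB; [exact: cvg_id|exact: cvg_cst].
  exact.
exists (2 `^ p) => t; rewrite ger0_norm ?le_max ?lexx// /tent ge_max mulr_ge0 ?powR_ge0//=.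
have [t2|t2] := leP `|t - 1| 2^-1.
  have th : 2^-1 <= `|t|.
    have : `|1| <= `|t| + `|t - 1|.
      by rewrite -[X in `|X| <= _](subKr t 1); exact: ler_normB.
    rewrite normr1; lra.
  apply: (@le_trans _ _ 1); first by rewrite lerBlDr lerDl mulr_ge0.
  have one : 1 `^ p = 1 :> R by rewrite powR1.
  rewrite -powRM// -[X in X <= _]one; apply: ge0_ler_powR; rewrite ?nnegrE ?(ltW p0)// ?mulr_ge0//.
  by lra.
by rewrite (@le_trans _ _ 0)// ?mulr_ge0 ?powR_ge0//; lra.
Qed.

Lemma moment_matrix_tent E : moment_matrix (tent \o (fun x => 1 * \1_E x)) =
  moment_matrix (\1_E : 'cV[R]_n -> R).
Proof.
congr moment_matrix; apply/funext => x /=; rewrite mul1r indicE.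
by case: (_ \in _); rewrite ?tent0 ?tent1.
Qed.

Lemma moment_indic_integrable E i j : mfin E -> leb.-integrable [set: LT]
  (EFin \o (fun x : LT => \1_E (x : 'cV[R]_n) * (x : 'cV[R]_n) i 0 * (x : 'cV[R]_n) j 0)).
Proof.
move=> fE; have := moment_integrable (tent_Atilde ltr01) i j (Lp_indic ltr01 1 fE).
apply: eq_integrable; first exact: measurableT.
move=> x _ /=; rewrite mul1r indicE.
by case: (_ \in _); rewrite ?tent0 ?tent1.
Qed.

Lemma moment_matrix_indic (xi : R -> R) a E : xi 0 = 0 -> mfin E ->
  moment_matrix (xi \o (fun x : 'cV[R]_n => a * \1_E x)) =
  xi a *: moment_matrix (\1_E : 'cV[R]_n -> R).
Proof.
move=> xi0 fE; apply/matrixP => i j; rewrite !mxE -RintegralZl; last 2 first.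
- exact: measurableT.
- exact: moment_indic_integrable.
apply: eq_Rintegral => x _ /=; rewrite indicE.
by case: (_ \in _); rewrite ?mulr1 ?mulr0 ?xi0 ?mul0r ?mulr0 ?mul1r// !mulrA.
Qed.

Lemma moment_cone_gt0 i :
  0 < moment_matrix (\1_(cone i 3 (fun=> 0) (fun=> 3)) : 'cV[R]_n -> R) i i.
Proof.
set C := cone _ _ _ _; have fC : mfin C by exact: mfin_cone.
have intC := moment_indic_integrable i i fC.
rewrite mxE /Rintegral fine_gt0//; apply/andP; split; last exact: integrable_lty intC.
have mQ := @measurable_cube R n 1 2.
have mQ' := measurable_borel_lebesgue mQ.
apply: (@lt_le_trans _ _ (leb (@cube R n 1 2))).
  by rewrite (lebesgue_cV_borel mQ) borel_cube ?ler1n// lte_fin exprn_gt0// subr_gt0 ltr1n.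
rewrite -[X in leb X]setIT -integral_indic; [|exact: measurableT|exact: mQ'].
apply: ge0_le_integral.
- exact: measurableT.
- by move=> x _; rewrite lee_fin.
- by apply/measurable_EFinP; exact: lebesgue_measurable_indic.
- exact: measurable_int intC.
move=> x _; rewrite lee_fin indicE; have [/set_mem xQ|_] := boolP (_ \in _); last first.
  by rewrite -mulrA mulr_ge0// -expr2 sqr_ge0.
have /andP[x1 x2] := xQ i.
rewrite indicE mem_set ?mul1r; last first.
  split; first by apply/andP; split; lra.
  by move=> k ki; have /andP[xk1 xk2] := xQ k; apply/andP; split; lra.
by rewrite -[1]mulr1 ler_pM// ltW.
Qed.

Lemma Lp_integral1E E : Lp_integral 1 (\1_E : 'cV[R]_n -> R) =
  (\int[leb]_x (\1_E (x : 'cV[R]_n) * enorm (x : 'cV[R]_n) ^+ 2)%:E)%E.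
Proof.
apply: eq_integral => x _; congr (_ * _)%:E; rewrite powRr1// indicE.
by case: (_ \in _); rewrite ?normr1 ?normr0.
Qed.

Lemma enormZ (r : R) (x : 'cV[R]_n) : enorm (r *: x) ^+ 2 = r ^+ 2 * enorm x ^+ 2.
Proof.
by rewrite !enorm_sqr mulr_sumr; apply: eq_bigr => i _; rewrite mxE exprMn.
Qed.

Lemma mfin_homothety (r : R) E : 0 < r -> mfin E ->
  [/\ mfin [set x | E (r^-1 *: x)],
      Lp_integral 1 (\1_[set x | E (r^-1 *: x)] : 'cV[R]_n -> R) =
        ((r ^+ n.+2)%:E * Lp_integral 1 (\1_E : 'cV[R]_n -> R))%E &
      forall i, moment_matrix (\1_[set x | E (r^-1 *: x)] : 'cV[R]_n -> R) i i =
        r ^+ n.+2 * moment_matrix (\1_E : 'cV[R]_n -> R) i i].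
Proof.
move=> r0 fE; have mE := mfin_measurable fE.
have rV0 : 0 < r^-1 by rewrite invr_gt0.
have mS : measurable ([set x | E (r^-1 *: x)] : set LT).
  by rewrite -[X in measurable X]setTI; exact: (measurable_homothety rV0).
have intE : Lp_integral 1 (\1_[set x | E (r^-1 *: x)] : 'cV[R]_n -> R) =
        ((r ^+ n.+2)%:E * Lp_integral 1 (\1_E : 'cV[R]_n -> R))%E.
  rewrite !Lp_integral1E; apply: (integral_indic_homothety r0 mE).
  - exact: measurable_enorm2.
  - by move=> x; rewrite sqr_ge0.
  - by move=> x; exact: enormZ.
split; [|exact: intE|].
- split; first exact: lebesgue_measurable_indic.
  by rewrite intE lte_mul_pinfty ?lee_fin ?exprn_ge0 ?(ltW r0)//; exact: fE.2.
- move=> i; rewrite !mxE /Rintegral.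
  have assoc (F : set 'cV[R]_n) : (\int[leb]_x (\1_F (x : 'cV[R]_n) * (x : 'cV[R]_n) i 0 * (x :
      'cV[R]_n) i 0)%:E
     = \int[leb]_x (\1_F (x : 'cV[R]_n) * ((x : 'cV[R]_n) i 0 * (x : 'cV[R]_n) i 0))%:E)%E.
    by apply: eq_integral => x _; rewrite mulrA.
  have intC := moment_indic_integrable i i fE.
  have finE : (\int[leb]_x (\1_E (x : 'cV[R]_n) * ((x : 'cV[R]_n) i 0 * (x : 'cV[R]_n) i
      0))%:E)%E \is a fin_num.
    by rewrite -assoc; exact: integrable_fin_num intC.
  rewrite !assoc (integral_indic_homothety r0 mE (q := fun x : 'cV[R]_n => x i 0 * x i 0)).
  + by rewrite fineM.
  + by apply: measurable_funM; exact: measurable_coord_lebesgue.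
  + by move=> x; rewrite -expr2 sqr_ge0.
  + by move=> x; rewrite !mxE; ring.
Qed.

End moments_of_sets.

Section representation.
Context {R : realType} (p : R) (n : nat) (Psi : ('cV[R]_n -> R) -> 'M[R]_n).
Hypotheses (p0 : 0 < p) (n2 : (2 < n)%N).
Hypotheses (cPsi : Lp_continuous p Psi) (sPsi : SL_covariant p Psi) (vPsi : valuation p Psi).
Local Notation moment := (@moment_matrix R n).

Lemma SL_covariant_0 : Psi (fun=> 0) = 0.
Proof.
by apply: SL_invariant_mx n2 _ => A detA; exact: (sPsi (Lp_0 n p0) detA).
Qed.

Let i0 : 'I_n := Ordinal (ltn_trans (ltn0Sn 1) n2).
Let C : set 'cV[R]_n := cone i0 3 (fun=> 0) (fun=> 3).
Let fC : mfin C. Proof. exact: mfin_cone. Qed.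
Let kappa : R := moment (\1_C : 'cV[R]_n -> R) i0 i0.
Let kappa0 : 0 < kappa. Proof. exact: moment_cone_gt0. Qed.

Definition level_coefficient (a : R) : R := Psi (fun x => a * \1_C x) i0 i0 / kappa.
Local Notation xi := level_coefficient.

Lemma moment_indic_covariant_charge :
  covariant_charge (fun E => moment (\1_E : 'cV[R]_n -> R)).
Proof.
have Ab := @tent_Atilde R p p0.
rewrite (_ : (fun E => _) = (fun E : set 'cV[R]_n => moment (tent \o (fun x : 'cV[R]_n => (1 : R)
    * \1_E x)))); last first.
  by apply/funext => E; rewrite moment_matrix_tent.
apply: (@covariant_charge_indic R n p 1 (fun h => moment (tent \o h)) p0).
- apply/matrixP => i j; rewrite !mxE /Rintegral integral0_eq// => x _ /=.
  by rewrite tent0 !mul0r.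
- exact: moment_matrix_continuous.
- by move=> h A Lh detA; exact: (moment_matrix_SL p0 Ab).
- by move=> h f Lh Lf; exact: (moment_matrix_valuation p0 Ab).
Qed.

Lemma valuation_indic a E : mfin E -> Psi (fun x => a * \1_E x) = xi a *: moment (\1_E : 'cV[R]_n
    -> R).
Proof.
move=> fE; apply/eqP; rewrite -subr_eq0; apply/eqP.
have cM := covariant_charge_sub (xi a)
  (covariant_charge_indic a p0 SL_covariant_0 cPsi sPsi vPsi) moment_indic_covariant_charge.
apply: (covariant_charge_eq0 n2 cM (l := i0) (b0 := 3) (al0 := fun=> 0) (be0 := fun=> 3)) => //.
by rewrite [LHS]mxE [X in _ + X]mxE [X in _ - X]mxE -/C -/kappa divfK ?subrr// gt_eqF.
Qed.

Lemma level_coefficient0 : xi 0 = 0.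
Proof.
rewrite /xi (_ : (fun x => _) = fun=> 0) ?SL_covariant_0 ?mxE ?mul0r//.
by apply/funext => x; rewrite mul0r.
Qed.

Lemma level_coefficient_continuous : continuous xi.
Proof.
move=> a; apply/(@cvg_nbhsP _ R^o) => u ua; apply: cvgMr_tmp.
apply: mx_cvg_coord; apply: (cPsi (fun k => Lp_indic p0 (u k) fC) (Lp_indic p0 a fC)).
apply/(Lp_norm_cvg0 _ p0).
have Ifin : Lp_integral 1 (\1_C : 'cV[R]_n -> R) \is a fin_num.
  by rewrite ge0_fin_numE ?Lp_integral_ge0//; exact: fC.2.
rewrite (_ : (fun k => _) = fun k => (`|u k - a| `^ p * fine (Lp_integral 1 (\1_C : 'cV[R]_n ->
    R)))%:E); last first.
  apply/funext => k; rewrite EFinM fineK// -(Lp_integral_indic p0 _ fC).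
  by congr Lp_integral; apply/funext => x; rewrite mulrBl.
apply/fine_cvgP; split; first exact: nearW.
rewrite -[X in _ --> X](mul0r (fine (Lp_integral 1 (\1_C : 'cV[R]_n -> R)))).
apply: cvgMr_tmp; apply: cvg_powR0 => //; apply/norm_cvg0P.
by rewrite -(subrr a); apply: cvgB => //; exact: cvg_cst.
Qed.

(* If xi outgrows |t|^p along t_k, homothetic copies of the cone of mass
   1 / ((k + 1) |t_k|^p) give functions tending to 0 on which Psi does not. *)
Lemma level_coefficient_growth : exists d : R, forall t, `|xi t| <= d * `|t| `^ p.
Proof.
apply: contrapT => nd.
have h (k : nat) : exists t, k.+1%:R * `|t| `^ p < `|xi t|.
  apply: contrapT => nt; apply: nd; exists k.+1%:R => t; rewrite leNgt; apply/negP => lt.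
  by apply: nt; exists t.
pose t k := projT1 (cid (h k)).
have tP k : k.+1%:R * `|t k| `^ p < `|xi (t k)| by exact: projT2 (cid (h k)).
have t0 k : t k != 0.
  apply/eqP => tk; have := tP k; rewrite tk level_coefficient0 normr0.
  by rewrite powR0 ?gt_eqF// mulr0 ltxx.
have tp0 k : 0 < `|t k| `^ p by apply: powR_gt0; rewrite normr_gt0.
pose I := fine (Lp_integral 1 (\1_C : 'cV[R]_n -> R)).
have IE : Lp_integral 1 (\1_C : 'cV[R]_n -> R) = I%:E.
  by rewrite fineK// ge0_fin_numE ?Lp_integral_ge0//; exact: fC.2.
have I0 : 0 < I.
  apply: lt_le_trans kappa0 _; rewrite -lee_fin -IE Lp_integral1E.
  have intC := moment_indic_integrable i0 i0 fC.
  rewrite /kappa mxE /Rintegral fineK; last exact: integrable_fin_num intC.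
  apply: ge0_le_integral.
  - exact: measurableT.
  - by move=> x _; rewrite lee_fin -mulrA mulr_ge0// -expr2 sqr_ge0.
  - exact: measurable_int intC.
  - apply/measurable_EFinP/measurable_funM; last exact: measurable_enorm2.
    exact: (lebesgue_measurable_indic (mfin_measurable fC)).
  move=> x _; rewrite lee_fin -mulrA ler_wpM2l//.
  exact: le_trans (ler_norm _) (coord_mul_le_enorm _ _ _).
pose s k : R := (k.+1%:R * `|t k| `^ p)^-1.
have s0 k : 0 < s k by rewrite invr_gt0 mulr_gt0.
pose r k : R := (s k / I) `^ n.+2%:R^-1.
have r0 k : 0 < r k by rewrite powR_gt0// divr_gt0.
have rE k : r k ^+ n.+2 = s k / I.
  rewrite -powR_mulrn ?(ltW (r0 k))// /r -powRrM mulVf ?pnatr_eq0// powRr1//.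
  by rewrite divr_ge0// ltW.
pose E k := [set x : 'cV[R]_n | C ((r k)^-1 *: x)].
have fE k : mfin (E k) by have [] := mfin_homothety (r0 k) fC.
have intE k : Lp_integral 1 (\1_(E k) : 'cV[R]_n -> R) = (s k)%:E.
  have [_ -> _] := mfin_homothety (r0 k) fC.
  by rewrite rE IE -EFinM divfK// gt_eqF.
have momE k : moment (\1_(E k) : 'cV[R]_n -> R) i0 i0 = s k / I * kappa.
  by have [_ _ ->] := mfin_homothety (r0 k) fC; rewrite rE.
have cv : Psi (fun x => t k * \1_(E k) x) @[k --> \oo] --> Psi (fun=> 0).
  apply: (cPsi (fun k => Lp_indic p0 (t k) (fE k)) (Lp_0 n p0)).
  apply/(Lp_norm_cvg0 _ p0).
  rewrite (_ : (fun k => _) = fun k => (k.+1%:R^-1 : R)%:E).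
    by apply/fine_cvgP; split; [exact: nearW|exact: cvg_harmonic].
  apply/funext => k; rewrite (_ : (fun x => _) = fun x => t k * \1_(E k) x); last first.
    by apply/funext => x; rewrite subr0.
  rewrite (Lp_integral_indic p0 _ (fE k)) intE -EFinM; congr EFin.
  by rewrite /s invfM mulrCA mulfV ?mulr1// gt_eqF.
have := mx_cvg_coord (i := i0) (j := i0) cv; rewrite SL_covariant_0 mxE.
move=> /cvgr0Pnorm_lt/(_ (kappa / I)).
rewrite divr_gt0// => /(_ isT) [N _ /(_ N (leqnn N))] /=.
rewrite (valuation_indic _ (fE N)) [X in `|X|]mxE momE ltNge => /negP; apply.
have sk : 0 <= s N / I * kappa by rewrite mulr_ge0 ?divr_ge0// ltW.
rewrite normrM (ger0_norm sk) [leRHS](_ : _ = `|xi (t N)| * s N * (kappa / I)); last by field;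
    rewrite gt_eqF.
rewrite ler_peMl ?divr_ge0 ?(ltW kappa0) ?(ltW I0)// /s ler_pdivlMr ?mul1r; last by rewrite
    mulr_gt0.
exact: ltW (tP N).
Qed.

Lemma continuous_covariant_valuation_moment : exists2 xi : R -> R, Atilde p xi &
  forall h : 'cV[R]_n -> R, Lp p h -> Psi h = moment (xi \o h).
Proof.
have Axi : Atilde p xi.
  by split; [exact: level_coefficient_continuous|exact: level_coefficient_growth].
exists xi; [exact: Axi|move=> h Lh].
pose Theta h := Psi h - moment (xi \o h).
apply/eqP; rewrite -subr_eq0; apply/eqP.
apply: (@valuation_eq0 R p n Theta p0 _ _ _ h Lh).
- move=> h_ f Lh_ Lf hf; apply: mx_cvg => i j.
  rewrite [X in X @ _ --> _](_ : _ = fun k => Psi (h_ k) i j - moment (xi \o h_ k) i j); last first.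
    by apply/funext => k; rewrite !mxE.
  rewrite [X in _ --> X](_ : _ = Psi f i j - moment (xi \o f) i j); last by rewrite !mxE.
  apply: cvgB; first exact: (mx_cvg_coord (cPsi Lh_ Lf hf)).
  exact: (mx_cvg_coord (moment_matrix_continuous p0 Axi Lh_ Lf hf)).
- move=> f g Lf Lg; rewrite /Theta addrACA -opprD (vPsi Lf Lg).
  by rewrite (moment_matrix_valuation p0 Axi Lf Lg) opprD addrACA.
- move=> a E fE; by rewrite /Theta (valuation_indic _ fE) (moment_matrix_indic _
    level_coefficient0 fE) subrr.
Qed.

End representation.

Theorem theorem5 (R : realType) (p : R) (n : nat) (hp : 1 <= p) (hn : (3 <= n)%N)
    (Psi : ('cV[R]_n -> R) -> 'M[R]_n) (hPsi : Lp_operator p Psi) :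
  (Lp_continuous p Psi /\ SL_covariant p Psi /\ valuation p Psi) <->
  (exists2 xi : R -> R, Atilde p xi &
     forall h : 'cV[R]_n -> R, Lp p h -> Psi h = moment_matrix (xi \o h)).
Proof.
have p0 : 0 < p by exact: lt_le_trans hp.
split=> [[cPsi [sPsi vPsi]]|[xi Axi PsiE]]; first exact: continuous_covariant_valuation_moment.
split; [|split].
- move=> h_ h Lh_ Lh hh; rewrite (PsiE _ Lh).
  rewrite (_ : (fun k => _) = fun k => moment_matrix (xi \o h_ k)); last first.
    by apply/funext => k; rewrite (PsiE _ (Lh_ k)).
  exact: (moment_matrix_continuous p0 Axi Lh_ Lh hh).
- move=> h A Lh detA; rewrite (PsiE _ Lh) (PsiE _ (Lp_SL p0 (det_invmx1 detA) Lh)).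
  exact: (moment_matrix_SL p0 Axi Lh detA).
- move=> h f Lh Lf; rewrite (PsiE _ (Lp_max p0 Lh Lf)) (PsiE _ (Lp_min p0 Lh Lf)).
  rewrite (PsiE _ Lh) (PsiE _ Lf); exact: (moment_matrix_valuation p0 Axi Lh Lf).
Qed.
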